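(* Suppose each agent $i\in\mathcal A$ has access to the observations $\{h_i(\hat\xi^{(1)}),\dots,h_i(\hat\xi^{(N)})\}$ of i.i.d. samples $\hat\xi^{(1)},\dots,\hat\xi^{(N)}$ of $\mathbb P^\star$, and that $h$ is inferable with inflation $C$. Suppose that for all $i\in\mathcal A$, $\theta_i\in(0,1)$ and $$\epsilon_i=\epsilon_i(N,\theta_i)=\begin{cases}\left(\dfrac{\log(c_1\theta_i^{-1})}{c_2N}\right)^{1/\max\{m,2\}}, & N\ge \dfrac{\log(c_1\theta_i^{-1})}{c_2},\\[2mm] \left(\dfrac{\log(c_1\theta_i^{-1})}{c_2N}\right)^{1/a}, & N<\dfrac{\log(c_1\theta_i^{-1})}{c_2}.\end{cases}$$ Assume that $(s_i^\star,s_{-i}^\star)\in\mathcal{NE}(\mathcal G^{DR})$, where the infimum defining $U_i^{DR}$ is taken over the closed Wasserstein ball of radius $\bar\epsilon_i=[C+1]\epsilon_i$, i.e. over $\mathbb Q\in\mathcal B_{\bar\epsilon_i}(\hat{\mathbb P}_h^N)$, for all $i\in\mathcal A$. Then, with probability at least $(1-\theta)^n$, $(s_i^\star,s_{-i}^\star)\in\mathcal{NE}_\eta(\mathcal G^S)$, where $\eta=2[C+1]\max_{i\in\mathcal A}\epsilon_iL_i$ and $\theta=\max_{i\in\mathcal A}\theta_i$.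
   Context: Let $\mathcal A=\{1,\dots,n\}$ be agents with strategy sets $\mathcal S_i$, $\mathcal S=\times_i\mathcal S_i$. Let $\Xi\subset\mathbb R^m$ be compact, $\mathcal M(\Xi)$ the set of probability distributions on $\Xi$ with bounded first and second order moments, and $\mathbb P^\star\in\mathcal M(\Xi)$ absolutely continuous with respect to Lebesgue measure and light-tailed with exponent $a>1$ ($\mathbb E_{\xi\sim\mathbb P^\star}[\exp(\|\xi\|^a)]<\infty$). Agent $i$ has utility $U_i(s_i,s_{-i};\xi)$. Standing assumption, for each $i$: $\mathcal S_i\subseteq\mathbb R^{n_i}$ is non-empty, convex, compact; $U_i$ is continuous and concave in $s_i$ for all $s_{-i},\xi$; $U_i(s_i,s_{-i};\xi)$ is $L_i$-Lipschitz in $\xi$ for all $s_i,s_{-i}$. The stacked observation function $h=[h_1^\top,\dots,h_n^\top]^\top:\mathbb R^m\to\mathbb R^m$ is invertible and measurable; $\hat{\mathbb P}_h^N=\frac1N\sum_k\delta_{h(\hat\xi^{(k)})}$. The Wasserstein distance is $d_W(\mathbb Q_1,\mathbb Q_2)=\inf_{\pi\in\Pi(\mathbb Q_1,\mathbb Q_2)}\int\|\xi_1-\xi_2\|_1\,\pi(d\xi_1,d\xi_2)$ ($\Pi$: couplings), and for $\mathbb P\in\mathcal M(\Xi)$, $\mathcal B_\varepsilon(\mathbb P)=\{\mathbb Q\in\mathcal M(\Xi):d_W(\mathbb Q,\mathbb P)\le\varepsilon\}$. The positive constants $c_1,c_2$ depend only on $a$ and $m$ and are those of the known concentration result: for $\hat{\mathbb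 P}^N=\frac1N\sum_k\delta_{\hat\xi^{(k)}}$ and $\epsilon$ given by the displayed formula with $\theta\in(0,1)$ in place of $\theta_i$, $\Pr\{\mathbb P^\star\in\mathcal B_\epsilon(\hat{\mathbb P}^N)\}\ge1-\theta$. Games: $\mathcal G^S=\langle\mathcal A,\{\mathcal S_i\},\{U_i^S\}\rangle$ with $U_i^S(s)=\mathbb E_{\xi\sim\mathbb P^\star}[U_i(s;\xi)]$; $\mathcal G^{DR}=\langle\mathcal A,\{\mathcal S_i\},\{U_i^{DR}\}\rangle$ with $U_i^{DR}(s)=\inf_{\mathbb Q}\mathbb E_{\xi\sim\mathbb Q}[U_i(s;\xi)]$, the infimum being over the ball stated in the claim. For a game with utilities $W_i$ and $\eta\ge0$, $s^\star$ is an $\eta$-Nash equilibrium iff $W_i(s_i^\star,s_{-i}^\star)+\eta\ge W_i(s_i,s_{-i}^\star)$ for all $s_i\in\mathcal S_i$, $i\in\mathcal A$; $\mathcal{NE}_\eta$ is the set of these, and $\mathcal{NE}=\mathcal{NE}_0$. Inferable observations: let $\hat{\mathbb P}_\Sigma^N=\frac1N\sum_{k=1}^N\mathcal N(\hat\xi^{(k)},\Sigma)$ (Gaussian mixture). Consider any sequence of (covariance) matrices $\Sigma_l\to O$ as $l\to\infty$. For each $l$ let $\mathcal T_l=\{T: T_\sharp\hat{\mathbb P}_{\Sigma_l}^N=\mathbb P^\star\}$ (measurable maps $\mathbb R^m\to\mathbb R^m$; $T_\sharp$ is push-forward). Suppose $h$ is such that for all $T\in\mathcal T_l$, $\int\|\xi-h(\xi)\|_1\,\hat{\mathbb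 P}_{\Sigma_l}^N(d\xi)\le C_l\int\|\xi-T(\xi)\|_1\,\hat{\mathbb P}_{\Sigma_l}^N(d\xi)$. Then $h$ is inferable with inflation $C$ if $\lim_{l\to\infty}C_l=C$. *)

(* Defs.v *)
From HB Require Import structures.
From mathcomp Require Import all_boot all_order all_algebra.
From mathcomp Require Import all_classical all_reals all_analysis.
From mathcomp Require Import measurable_realfun.

Set Implicit Arguments.
Unset Strict Implicit.
Unset Printing Implicit Defensive.

Import Order.TTheory GRing.Theory Num.Theory.
Import numFieldNormedType.Exports.

Local Open Scope classical_set_scope.
Local Open Scope ring_scope.

(* The sigma-algebra of R^m is the one generated by the coordinates, that is,
   the Borel sigma-algebra. *)
Definition rV_display : measure_display. Proof. exact: default_measure_display. Qed.

Section measurable_rV.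
Context {R : realType} {m : nat}.

Let coor (i : 'I_m) (v : 'rV[R]_m) : measurableTypeR R := v 0 i.

Let rV_set0 : g_sigma_preimage coor set0.
Proof. exact: sigma_algebra0. Qed.

Let rV_setC A : g_sigma_preimage coor A -> g_sigma_preimage coor (~` A).
Proof. exact: sigma_algebraC. Qed.

Let rV_bigcup (F : (set _)^nat) : (forall i, g_sigma_preimage coor (F i)) ->
  g_sigma_preimage coor (\bigcup_i (F i)).
Proof. exact: sigma_algebra_bigcup. Qed.

HB.instance Definition _ := @isMeasurable.Build rV_display
  'rV[R]_m (g_sigma_preimage coor) rV_set0 rV_setC rV_bigcup.

Lemma measurable_coor (i : 'I_m) :
  measurable_fun setT (fun v : 'rV[R]_m => v 0 i).
Proof.
move=> _ Y mY; rewrite setTI; apply: sub_sigma_algebra => /=.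
rewrite -bigcup_seq/=; exists i => /=; first by rewrite mem_index_enum.
by exists Y => //; rewrite setTI.
Qed.

Lemma measurable_fun_rV d (T : measurableType d) (f : T -> 'rV[R]_m) :
  (forall i, measurable_fun setT (fun x => f x 0 i)) -> measurable_fun setT f.
Proof.
move=> mf.
have sub : g_sigma_preimage (fun i => coor i \o f) `<=` measurable.
  apply: smallest_sub; first exact: sigma_algebra_measurable.
  rewrite -bigcup_seq => A [i _ [B mB <-]].
  exact: (mf i).
by rewrite g_sigma_preimage_comp in sub => _ A mA; apply: sub; exists A.
Qed.

End measurable_rV.

Section sigma_finite_prod.
Context {R : realType} d1 d2 (T1 : measurableType d1) (T2 : measurableType d2).
Variables (mu1 : {sigma_finite_measure set T1 -> \bar R})
  (mu2 : {sigma_finite_measure set T2 -> \bar R}).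

Lemma sigma_finite_prod : sigma_finite setT (mu1 \x mu2)%E.
Proof.
have /sigma_finiteP[F [TF ndF Foo]] := sigma_finiteT mu1.
have /sigma_finiteP[G [TG ndG Goo]] := sigma_finiteT mu2.
exists (fun n => F n `*` G n).
  rewrite -setXTT TF TG predeqE => -[x y]; split.
    move=> [/= [n _ Fnx] [k _ Gky]]; exists (maxn n k) => //; split.
    - by move: x Fnx; exact/subsetPset/ndF/leq_maxl.
    - by move: y Gky; exact/subsetPset/ndG/leq_maxr.
  by move=> [n _ []/= ? ?]; split; exists n.
move=> k; have [? ?] := Foo k; have [? ?] := Goo k.
split; first exact: measurableX.
by rewrite product_measure1E// lte_mul_pinfty// ge0_fin_numE.
Qed.

End sigma_finite_prod.

Section lebesgue_rV.
Context {R : realType}.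

Definition consv m (z : R * 'rV[R]_m) : 'rV[R]_m.+1 :=
  row_mx (z.1)%:M z.2 : 'rV[R]_(1 + m).

Definition unconsv m (v : 'rV[R]_m.+1) : measurableTypeR R * 'rV[R]_m :=
  (v 0 0, rsubmx (v : 'rV[R]_(1 + m))).

Lemma consvK m : cancel (@consv m) (@unconsv m).
Proof.
move=> [x v]; rewrite /unconsv /consv/= row_mxKr; congr pair.
have -> : (0 : 'I_m.+1) = lshift m (0 : 'I_1) by apply/val_inj.
by rewrite (@row_mxEl _ 1 1 m) mxE eqxx mulr1n.
Qed.

Lemma measurable_consv m :
  measurable_fun setT (@consv m : measurableTypeR R * 'rV[R]_m -> _).
Proof.
apply: measurable_fun_rV => i.
have [j ->|j ->] := split_ordP (i : 'I_(1 + m)).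
  apply: (eq_measurable_fun fst) => // -[x v] _.
  by rewrite /consv (@row_mxEl _ 1 1 m) mxE !ord1 mulr1n.
apply: (eq_measurable_fun (fun z : measurableTypeR R * 'rV[R]_m => z.2 0 j)).
  by move=> [x v] _; rewrite /consv (@row_mxEr _ 1 1 m).
exact: measurableT_comp (measurable_coor j) measurable_snd.
Qed.

Lemma measurable_unconsv m : measurable_fun setT (@unconsv m).
Proof.
apply/measurable_fun_pairP; split; first exact: measurable_coor.
apply: measurable_fun_rV => i.
apply: (eq_measurable_fun (fun v : 'rV[R]_m.+1 => v 0 (rshift 1 i))).
  by move=> v _; rewrite /= mxE.
exact: measurable_coor.
Qed.

Section step.
Variables (m : nat) (mu : {sigma_finite_measure set 'rV[R]_m -> \bar R}).

Definition leb_step : set 'rV[R]_m.+1 -> \bar R :=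
  pushforward (@lebesgue_measure R \x mu)%E (@consv m).

Let leb0 : leb_step set0 = 0%E.
Proof. by rewrite /leb_step /pushforward preimage_set0 measure0. Qed.

Let leb_ge0 A : (0 <= leb_step A)%E.
Proof. by apply: measure_ge0; exact: measurable_consv. Qed.

Let leb_sigma_additive : semi_sigma_additive leb_step.
Proof.
apply: measure_semi_sigma_additive; exact: measurable_consv.
Qed.

HB.instance Definition _ := isMeasure.Build _ _ _ leb_step
  leb0 leb_ge0 leb_sigma_additive.

Let leb_sigma_finite : sigma_finite setT leb_step.
Proof.
have [F UF Foo] : sigma_finite setT (@lebesgue_measure R \x mu)%E.
  exact: sigma_finite_prod.
exists (fun n => @unconsv m @^-1` F n).
  by rewrite -preimage_bigcup -UF preimage_setT.
move=> n; have [mF Fn] := Foo n; split.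
  by rewrite -[X in measurable X]setTI; exact: measurable_unconsv.
suff -> : leb_step (@unconsv m @^-1` F n) = (lebesgue_measure \x mu)%E (F n) by [].
rewrite /leb_step /pushforward -comp_preimage; congr (_ _).
by apply/seteqP; split => z /=; rewrite consvK.
Qed.

HB.instance Definition _ := Measure_isSigmaFinite.Build _ _ _ leb_step
  leb_sigma_finite.
End step.

(* Lebesgue measure on R^m as an iterated product of the one on R; on R^0 it is
   the unit mass. *)
Fixpoint lebesgue_rV (m : nat) : {sigma_finite_measure set 'rV[R]_m -> \bar R} :=
  match m with
  | 0 => [the {sigma_finite_measure set _ -> \bar R} of \d_(0 : 'rV[R]_0)]
  | m'.+1 => [the {sigma_finite_measure set _ -> \bar R} of leb_step (lebesgue_rV m')]
  end.

End lebesgue_rV.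

Section gaussian.
Context {R : realType} {m : nat}.
Implicit Types (mu v : 'rV[R]_m) (Sigma : 'M[R]_m).

(* Positive definite, so that the normal distribution has a density. *)
Definition pd_covariance Sigma :=
  Sigma^T = Sigma /\
  forall v, v != 0 -> 0 < (v *m Sigma *m v^T) 0 0.

Definition gaussian_pdf mu Sigma v : R :=
  (Num.sqrt ((2 * pi) ^+ m * \det Sigma))^-1 *
  expR (- ((v - mu) *m invmx Sigma *m (v - mu)^T) 0 0 / 2).

Lemma gaussian_pdf_ge0 mu Sigma v : 0 <= gaussian_pdf mu Sigma v.
Proof. by rewrite mulr_ge0 ?invr_ge0 ?sqrtr_ge0 ?expR_ge0. Qed.

Lemma measurable_gaussian_pdf mu Sigma :
  measurable_fun setT (gaussian_pdf mu Sigma).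
Proof.
apply: measurable_funM => //; apply: measurableT_comp => //.
apply: measurable_funM => //; apply: measurableT_comp => //.
apply: (eq_measurable_fun (fun v : 'rV[R]_m => \sum_j
    (\sum_i (v 0 i - mu 0 i) * invmx Sigma i j) * (v 0 j - mu 0 j))).
  move=> v _; rewrite mxE; apply: eq_bigr => j _; rewrite !mxE.
  by congr (_ * _); apply: eq_bigr => i _; rewrite !mxE.
have mB i : measurable_fun setT (fun v : 'rV[R]_m => v 0 i - mu 0 i).
  by apply: measurable_funB => //; exact: measurable_coor.
apply: measurable_sum => j; apply: measurable_funM => //.
by apply: measurable_sum => i; exact: measurable_funM.
Qed.

Definition gaussian mu Sigma (A : set 'rV[R]_m) : \bar R :=
  (\int[lebesgue_rV m]_(v in A) (gaussian_pdf mu Sigma v)%:E)%E.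

Section gaussian_measure.
Variables (mu : 'rV[R]_m) (Sigma : 'M[R]_m).

Let gaussian0 : gaussian mu Sigma set0 = 0%E.
Proof. exact: integral_set0. Qed.

Let gaussian_ge0 A : (0 <= gaussian mu Sigma A)%E.
Proof. by apply: integral_ge0 => v _; rewrite lee_fin gaussian_pdf_ge0. Qed.

Let gaussian_sigma_additive : semi_sigma_additive (gaussian mu Sigma).
Proof.
move=> F mF tF mUF; rewrite /gaussian ge0_integral_bigcup//; last first.
- by move=> v _; rewrite lee_fin gaussian_pdf_ge0.
- apply/measurable_EFinP; apply: measurable_funTS.
  exact: measurable_gaussian_pdf.
apply: is_cvg_ereal_nneg_natsum_cond => n _ _.
by apply: integral_ge0 => v _; rewrite lee_fin gaussian_pdf_ge0.
Qed.

HB.instance Definition _ := isMeasure.Build _ _ _ (gaussian mu Sigma)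
  gaussian0 gaussian_ge0 gaussian_sigma_additive.
End gaussian_measure.

End gaussian.

Section mixture.
Local Open Scope ereal_scope.
Context d (T : measurableType d) {R : realType} (N : nat).
Variable nu : 'I_N -> {measure set T -> \bar R}.

Definition mixture (A : set T) : \bar R :=
  (N%:R^-1 : R)%R%:E * \sum_(k < N) nu k A.

Let nu' (k : nat) : {measure set T -> \bar R} :=
  oapp nu mzero (insub k).

Let mixtureE : mixture = mscale ((N%:R^-1 : R)%:nng)%R (msum nu' N).
Proof.
apply/funext => A; rewrite /mixture /mscale /= /msum; congr (_ * _).
by apply: eq_bigr => i _; rewrite /nu' valK.
Qed.

Let mixture0 : mixture set0 = 0.
Proof. by rewrite mixtureE measure0. Qed.

Let mixture_ge0 A : 0 <= mixture A.
Proof. by rewrite mixtureE measure_ge0. Qed.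

Let mixture_sigma_additive : semi_sigma_additive mixture.
Proof. by rewrite mixtureE; exact: measure_semi_sigma_additive. Qed.

HB.instance Definition _ := isMeasure.Build _ _ _ mixture
  mixture0 mixture_ge0 mixture_sigma_additive.

End mixture.

Section wasserstein.
Context {R : realType} {m : nat}.
Implicit Types (Xi : set 'rV[R]_m) (mu nu : {measure set 'rV[R]_m -> \bar R}).

Definition norm1 (v : 'rV[R]_m) : R := \sum_(i < m) `|v 0 i|.

Definition MXi Xi : set (probability 'rV[R]_m R) :=
  [set Q | [/\ Q Xi = 1%E,
    (\int[Q]_x (norm1 x)%:E < +oo)%E &
    (\int[Q]_x (norm1 x ^+ 2)%:E < +oo)%E]].

Definition couplings mu nu : set (probability ('rV[R]_m * 'rV[R]_m)%type R) :=
  [set pi | forall A, measurable A ->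
    pi (A `*` setT) = mu A /\ pi (setT `*` A) = nu A].

Definition wasserstein mu nu : \bar R :=
  ereal_inf [set (\int[pi]_z (norm1 (z.1 - z.2))%:E)%E | pi in couplings mu nu].

(* The centre need not be supported in Xi, but the elements of the ball are. *)
Definition wball Xi (r : R) mu : set (probability 'rV[R]_m R) :=
  [set Q | MXi Xi Q /\ (wasserstein Q mu <= r%:E)%E].

Definition empirical N (x : 'I_N -> 'rV[R]_m) : {measure set 'rV[R]_m -> \bar R} :=
  mixture (fun k => \d_(x k)).

Definition gaussian_mixture N (x : 'I_N -> 'rV[R]_m) (Sigma : 'M[R]_m) :
    {measure set 'rV[R]_m -> \bar R} :=
  mixture (fun k => gaussian (x k) Sigma).

Definition transport_maps mu nu : set ('rV[R]_m -> 'rV[R]_m) :=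
  [set T | measurable_fun setT T /\
    forall A, measurable A -> pushforward mu T A = nu A].

Definition light_tailed (a : R) mu :=
  (\int[mu]_x (expR (norm1 x `^ a))%:E < +oo)%E.

(* The inflation constants Cl may depend on the sample x and on the sequence of
   covariances; their limit C may not. *)
Definition inferable (Pstar : {measure set 'rV[R]_m -> \bar R}) N
    (x : 'I_N -> 'rV[R]_m) (h : 'rV[R]_m -> 'rV[R]_m) (C : R) :=
  forall Sigma : nat -> 'M[R]_m,
    (forall l, pd_covariance (Sigma l)) -> Sigma l @[l --> \oo] --> (0 : 'M[R]_m) ->
  exists Cl : nat -> R,
    (forall l T, transport_maps (gaussian_mixture x (Sigma l)) Pstar T ->
      (\int[gaussian_mixture x (Sigma l)]_v (norm1 (v - h v))%:E <=
       (Cl l)%:E * \int[gaussian_mixture x (Sigma l)]_v (norm1 (v - T v))%:E)%E) /\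
    Cl l @[l --> \oo] --> C.

End wasserstein.

Section sampling.
Context {R : realType} {m : nat}.

(* Probability at least p, for an event that need not be measurable. *)
Definition prob_at_least d (Omega : measurableType d) (P : probability Omega R)
    (p : R) (E : set Omega) :=
  exists F, [/\ measurable F, F `<=` E & (p%:E <= P F)%E].

Definition iid d (Omega : measurableType d) (P : probability Omega R) N
    (X : 'I_N -> {RV P >-> 'rV[R]_m}) (Q : probability 'rV[R]_m R) :=
  (forall k A, measurable A -> distribution P (X k) A = Q A) /\
  (forall (J : {set 'I_N}) (A : 'I_N -> set 'rV[R]_m),
    (forall k, measurable (A k)) ->
    P (\bigcap_(k in [set` J]) X k @^-1` A k) =
    (\prod_(k in J) P (X k @^-1` A k))%E).

Definition conc_radius (a c1 c2 : R) (N : nat) (theta : R) : R :=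
  let q := ln (c1 * theta^-1) / (c2 * N%:R) in
  if ln (c1 * theta^-1) / c2 <= N%:R then q `^ (maxn m 2)%:R^-1
  else q `^ a^-1.

(* c1, c2 are constants of the measure concentration inequality for samples of
   size N of Pstar.  This is a property of Pstar: over all light-tailed laws at
   once no such constants exist, since the exponential moment is not bounded
   uniformly. *)
Definition concentration (Xi : set 'rV[R]_m) (Pstar : probability 'rV[R]_m R)
    (a c1 c2 : R) (N : nat) :=
  forall d (Omega : measurableType d) (P : probability Omega R)
    (X : 'I_N -> {RV P >-> 'rV[R]_m}), iid X Pstar ->
  forall theta, 0 < theta < 1 ->
  prob_at_least P (1 - theta)
    [set w | wball Xi (conc_radius a c1 c2 N theta) (empirical (fun k => X k w)) Pstar].

End sampling.
Arguments conc_radius {R} m a c1 c2 N theta.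

Section games.
Context {R : realType} {n : nat} {dim : 'I_n -> nat}.

Definition profile := forall i, 'rV[R]_(dim i).

Variable S : forall i, set 'rV[R]_(dim i).
Arguments S : clear implicits.

Definition strategies : set profile := [set s | forall i, S i (s i)].

(* eta-Nash equilibria; dfwith s i x is the profile (x, s_{-i}). *)
Definition NE (W : 'I_n -> profile -> \bar R) (eta : R) : set profile :=
  [set s | strategies s /\
    forall i x, S i x -> (W i (dfwith s i x) <= W i s + eta%:E)%E].

Section utilities.
Context {m : nat}.
Variables (Xi : set 'rV[R]_m) (U : 'I_n -> profile -> 'rV[R]_m -> R).

Definition US (P : probability 'rV[R]_m R) (i : 'I_n) (s : profile) : \bar R :=
  (\int[P]_(x in Xi) (U i s x)%:E)%E.

(* The infimum over an empty ball is +oo. *)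
Definition UDR (r : 'I_n -> R) (mu : {measure set 'rV[R]_m -> \bar R})
    (i : 'I_n) (s : profile) : \bar R :=
  ereal_inf [set US Q i s | Q in wball Xi (r i) mu].

(* Concavity is convexity of the opposite; the Lipschitz condition is with
   respect to the ground norm of the Wasserstein distance. *)
Definition standing (L : 'I_n -> R) (i : 'I_n) :=
  [/\ S i !=set0, convex_set (S i) & compact (S i)] /\
  (forall s x, strategies s -> Xi x ->
    {within S i, continuous (fun y => U i (dfwith s i y) x)} /\
    convex_function (S i) (fun y => - U i (dfwith s i y) x)) /\
  0 <= L i /\
  (forall s, strategies s -> forall x y, Xi x -> Xi y ->
    `|U i s x - U i s y| <= L i * norm1 (x - y)).

End utilities.
End games.
Arguments profile R {n} dim.

Definition stacked (R : realType) (n m : nat) (p : 'I_n -> nat)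
    (pm : (\sum_i p i)%N = m) (hs : forall i, 'rV[R]_m -> 'rV[R]_(p i))
    (x : 'rV[R]_m) : 'rV[R]_m :=
  castmx (erefl, pm) (\mxrow_i hs i x).

(* Main.v *)
(** The balls of radius [epsilon_i] around the empirical law are nested, so one
event, that of the smallest radius [e], serves all the agents; its probability
is at least [1 - theta >= (1 - theta) ^ n].  Let [x_k] be the sample points.

On that event the mean displacement [(1/N) sum_k |x_k - h x_k|] is at most
[C e].  Apply inferability along the covariances [s_l ^ 2 I].  The Gaussian
mixture has no atoms, so some transport map to [Pstar] costs at most
[e + O(s_l)]: cut the space into small cells and, in each cell, push the mixture
(via the distribution function of one coordinate, a quantile function and a
Borel coding of vectors by reals) onto the part of [Pstar] that a near-optimal
coupling sends there.  Conversely [h] is only measurable, but only a lower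
bound on the mixture integral of [|v - h v|] is needed, and for a suitable
subsequence of [s_l] Gaussian averages of a nonnegative function are
asymptotically at least its value at Lebesgue-almost every point, hence at the
[x_k].

Moving the atoms of a coupling from [x_k] to [h x_k] puts [Pstar] in the ball
of radius [(C + 1) e] around the law of the observations.  For two laws in
a ball of radius [r], decomposing couplings along the atoms of the centre bounds
the difference of the expectations of an [L]-Lipschitz function by [2 L r], even
if the atoms lie outside the domain [Xi] of the function.  Comparing [Pstar]
with each law of the ball gives the equilibrium inequality. *)

Require Import Defs.
From HB Require Import structures.
From mathcomp Require Import all_boot all_order all_algebra.
From mathcomp Require Import all_classical all_reals all_analysis.
From mathcomp Require Import finmap measurable_realfun ring lra.

Set Implicit Arguments.
Unset Strict Implicit.
Unset Printing Implicit Defensive.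

Import Order.TTheory GRing.Theory Num.Theory.
Import numFieldNormedType.Exports.

Local Open Scope classical_set_scope.
Local Open Scope ring_scope.

(** * Tonelli's theorem for Lebesgue measure on row vectors *)

Section product_integral.
Context {R : realType}.

Lemma consvE0 m (z : R * 'rV[R]_m) : consv z 0 0 = z.1.
Proof. by have := consvK z; case: z => x v /(congr1 fst). Qed.

Lemma consvES m (z : R * 'rV[R]_m) (i : 'I_m) :
  consv z 0 (lift ord0 i) = z.2 0 i.
Proof.
have -> : lift ord0 i = rshift 1 i by apply/val_inj.
by rewrite /consv (@row_mxEr _ 1 1 m).
Qed.

Lemma measurable_prod_coor m (f : 'I_m -> R -> R) :
  (forall i, measurable_fun setT (f i)) ->
  measurable_fun setT (fun v : 'rV[R]_m => \prod_i f i (v 0 i)).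
Proof.
move=> mf; apply: measurable_prod => i _.
exact: measurableT_comp (mf i) (measurable_coor i).
Qed.

(** Lebesgue measure in dimension [m.+1] is the image under [consv] of the product of the line with
    dimension [m], so Tonelli splits off one factor at a time; in dimension 0 both sides are 1. *)
Lemma integral_prod_coor m (f : 'I_m -> R -> R) :
  (forall i, measurable_fun setT (f i)) -> (forall i t, 0 <= f i t) ->
  (\int[lebesgue_rV m]_v (\prod_i f i (v 0 i))%:E =
   \prod_i \int[lebesgue_measure]_t (f i t)%:E)%E.
Proof.
elim: m f => [|m IH] f mf f0.
  rewrite big_ord0 (eq_integral (cst 1%E)); last by move=> v _; rewrite big_ord0.
  rewrite integral_cst//= mul1e.
  by rewrite diracT.
rewrite big_ord_recl -IH//.
rewrite [lebesgue_rV _]/=.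
rewrite ge0_integral_pushforward//; first last.
- by move=> v _; rewrite lee_fin prodr_ge0.
- by apply/measurable_EFinP; exact: measurable_prod_coor.
- exact: measurable_consv.
have mg : measurable_fun setT (fun v : 'rV[R]_m =>
    \prod_i f (lift ord0 i) (v 0 i)).
  exact: (@measurable_prod_coor m (fun i => f (lift ord0 i))).
transitivity (\int[(lebesgue_measure \x lebesgue_rV m)%E]_z
   ((f ord0 z.1)%:E * (\prod_i f (lift ord0 i) (z.2 0 i))%:E))%E.
  apply: eq_integral => z _; rewrite /= big_ord_recl EFinM consvE0.
  by congr (_ * EFin _)%E; apply: eq_bigr => i _; rewrite consvES.
rewrite fubini_tonelli1/=; first last.
- by move=> z; apply: mule_ge0; rewrite lee_fin// prodr_ge0.
- apply: emeasurable_funM; apply/measurable_EFinP.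
    exact: measurableT_comp (mf _) measurable_fst.
  exact: measurableT_comp mg measurable_snd.
transitivity (\int[lebesgue_measure]_x ((f ord0 x)%:E *
    \int[lebesgue_rV m]_v (\prod_(i < m) f (lift ord0 i) (v 0 i))%:E))%E.
  apply: eq_integral => x _; rewrite /fubini_F/=.
  rewrite ge0_integralZl_EFin//.
  - by move=> v _; rewrite lee_fin prodr_ge0.
  - exact/measurable_EFinP.
rewrite ge0_integralZr//.
- by apply/measurable_EFinP; exact: mf.
- by move=> x _; rewrite lee_fin.
- by apply: integral_ge0 => v _; rewrite lee_fin prodr_ge0.
Qed.

End product_integral.

(** * Integrals against densities *)

Section nonneg_induction.
Local Open Scope ereal_scope.
Context d (T : measurableType d) (R : realType).
Import HBNNSimple.
Variable Pr : (T -> \bar R) -> Prop.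

(** A nonnegative measurable function is an increasing limit of simple functions, and each of these
    is a finite nonnegative combination of indicators. *)
Lemma ge0_measurable_fun_ind :
  (forall A, measurable A -> Pr (EFin \o \1_A)) ->
  (forall (k : R) f, (0 <= k)%R -> measurable_fun setT f ->
    (forall x, 0 <= f x) -> Pr f -> Pr (fun x => k%:E * f x)) ->
  (forall f g, measurable_fun setT f -> (forall x, 0 <= f x) ->
    measurable_fun setT g -> (forall x, 0 <= g x) ->
    Pr f -> Pr g -> Pr (fun x => f x + g x)) ->
  (forall f : nat -> T -> \bar R, (forall n, measurable_fun setT (f n)) ->
    (forall n x, 0 <= f n x) -> (forall x, nondecreasing_seq (f ^~ x)) ->
    (forall n, Pr (f n)) -> Pr (fun x => limn (f ^~ x))) ->
  forall f, measurable_fun setT f -> (forall x, 0 <= f x) -> Pr f.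
Proof.
move=> P1 PZ PD Plim f mf f0.
pose h := nnsfun_approx measurableT mf.
have -> : f = fun x => limn (fun n => (h n x)%:E).
  apply/funext => x; apply/esym/cvg_lim => //.
  by apply: cvg_nnsfun_approx => // y _; exact: f0.
apply: (Plim (fun n x => (h n x)%:E)).
- by move=> n; apply/measurable_EFinP; exact/measurable_funP.
- by move=> n x; rewrite lee_fin.
- by move=> x a b ab; rewrite lee_fin; exact/lefP/nd_nnsfun_approx.
- move=> n.
  (* Base of the induction on the list of values of [h n]; zero is the indicator of the empty
     set. *)
  have P0 : Pr (fun=> 0).
    rewrite (_ : (fun=> 0) = EFin \o \1_set0); first exact: P1.
    by apply/funext => x; rewrite /= indic0.
  have -> : (fun x => (h n x)%:E) = (fun x =>
      \sum_(y <- fset_set (range (h n))) (y * \1_(h n @^-1` [set y]) x)%:E).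
    by apply/funext => x; rewrite /= [in LHS]fimfunE fsbig_finite//= sumEFin.
  have : forall y, y \in enum_fset (fset_set (range (h n))) -> (0 <= y)%R.
    move=> y yh; have : y \in fset_set (range (h n)) by [].
    by rewrite in_fset_set// => /set_mem[x _ <-].
  have mi y : measurable_fun setT
      (fun x => (y * \1_(h n @^-1` [set y]) x)%:E).
    by apply/measurable_EFinP; exact: measurable_funM.
  elim: (enum_fset _) => [_|y s IH ys0].
    by rewrite (_ : (fun=> _) = fun=> 0)//; apply/funext => x; rewrite big_nil.
  have y0 : (0 <= y)%R by apply: ys0; rewrite inE eqxx.
  have s0 z : z \in s -> (0 <= z)%R by move=> zs; apply: ys0; rewrite inE zs orbT.
  rewrite (_ : (fun=> _) = fun x => (y * \1_(h n @^-1` [set y]) x)%:E +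
      \sum_(y <- s) (y * \1_(h n @^-1` [set y]) x)%:E); last first.
    by apply/funext => x; rewrite big_cons.
  apply: PD => //.
  + by move=> x; rewrite lee_fin mulr_ge0.
  + exact: emeasurable_sum.
  + move=> x; rewrite big_seq; apply: sume_ge0 => z zs.
    by rewrite lee_fin mulr_ge0// s0.
  + apply: (PZ y (EFin \o \1_(h n @^-1` [set y]))) => //.
    * by apply/measurable_EFinP.
    * by move=> x; rewrite lee_fin.
    * exact: P1.
  + exact: IH.
Qed.

End nonneg_induction.

Section density.
Local Open Scope ereal_scope.
Context d (T : measurableType d) (R : realType).

(** Serves for the Gaussian density against Lebesgue measure and, with an indicator as density, for
    the restriction of a measure to a set. *)
Lemma ge0_integral_density (mu nu : {measure set T -> \bar R}) (g : T -> R) :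
  measurable_fun setT g -> (forall x, 0 <= g x)%R ->
  (forall A, measurable A -> nu A = \int[mu]_(x in A) (g x)%:E) ->
  forall f : T -> \bar R, measurable_fun setT f -> (forall x, 0 <= f x) ->
  \int[nu]_x f x = \int[mu]_x (f x * (g x)%:E).
Proof.
move=> mg g0 nuE; have mgE := proj2 (measurable_EFinP _ _) mg.
apply: ge0_measurable_fun_ind.
- move=> A mA; rewrite integral_indic// setIT nuE// integral_mkcond.
  apply: eq_integral => x _; rewrite /= patchE indicE.
  by case: (x \in A); rewrite ?mul1e ?mul0e.
- move=> k f k0 mf f0 IH; rewrite ge0_integralZl_EFin// IH.
  rewrite -ge0_integralZl_EFin//.
  + by apply: eq_integral => x _; rewrite muleA.
  + by move=> x _; rewrite mule_ge0// lee_fin.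
  + exact: emeasurable_funM.
- move=> f1 f2 mf1 f10 mf2 f20 IH1 IH2; rewrite ge0_integralD// IH1 IH2.
  rewrite -ge0_integralD//.
  + by apply: eq_integral => x _; rewrite ge0_muleDl.
  + by move=> x _; rewrite mule_ge0// lee_fin.
  + exact: emeasurable_funM.
  + by move=> x _; rewrite mule_ge0// lee_fin.
  + exact: emeasurable_funM.
- move=> f mf f0 ndf IH; rewrite monotone_convergence//.
  under eq_fun do rewrite IH.
  rewrite -monotone_convergence//.
  + apply: eq_integral => x _; apply/cvg_lim => //.
    apply: cvgeZr => //.
    by apply: ereal_nondecreasing_is_cvgn; exact: ndf.
  + by move=> n; exact: emeasurable_funM.
  + by move=> n x _; rewrite mule_ge0// lee_fin.
  + by move=> x _ a b ab; rewrite lee_wpmul2r ?lee_fin//; exact: ndf.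
Qed.

End density.

(** * Isotropic Gaussian laws *)

Section scalar_gaussian.
Context {R : realType} {m : nat}.
Implicit Types (x v : 'rV[R]_m) (s : R).

Lemma gaussian_pdf_scalar s x v : 0 < s ->
  gaussian_pdf x ((s ^+ 2)%:M) v = \prod_i normal_pdf (x 0 i) s (v 0 i).
Proof.
move=> s0; have s_neq0 : s != 0 by rewrite gt_eqF.
under eq_bigr do rewrite normal_pdfE//.
rewrite big_split/= /gaussian_pdf; congr (_ * _).
  rewrite prodr_const card_ord det_scalar -exprMn /normal_peak exprVn.
  congr (_^-1).
  have -> : s ^+ 2 * pi *+ 2 = 2 * pi * s ^+ 2 by rewrite -[LHS]mulr_natl; ring.
  elim: m => [|k IH]; first by rewrite !expr0 sqrtr1.
  rewrite exprS sqrtrM ?IH -?exprS//.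
  by rewrite mulr_ge0 ?sqr_ge0// mulr_ge0 ?pi_ge0.
rewrite /normal_fun -expR_sum; congr expR.
rewrite invmx_scalar mul_mx_scalar -scalemxAl !mxE mulr_sumr -sumrN mulr_suml.
by apply: eq_bigr => i _; rewrite !mxE; field.
Qed.

(** The isotropic density depends on the squared coordinate differences only. This symmetry drives
    the leak estimates below. *)
Lemma gaussian_pdf_sym s x v : 0 < s ->
  gaussian_pdf x ((s ^+ 2)%:M) v = gaussian_pdf v ((s ^+ 2)%:M) x.
Proof.
move=> s0; rewrite !gaussian_pdf_scalar//; apply: eq_bigr => i _.
rewrite (normal_pdfE (x 0 i)) ?gt_eqF// (normal_pdfE (v 0 i)) ?gt_eqF//.
by rewrite /normal_fun -[in LHS]sqrrN opprB.
Qed.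

Lemma integral_gaussian_coor s x i (g : R -> R) : 0 < s ->
  measurable_fun setT g -> (forall t, 0 <= g t) ->
  (\int[gaussian x ((s ^+ 2)%:M)]_v (g (v 0 i))%:E =
   \int[lebesgue_measure]_t (g t * normal_pdf (x 0 i) s t)%:E)%E.
Proof.
move=> s0 mg g0.
rewrite (ge0_integral_density (mu := lebesgue_rV m)
  (measurable_gaussian_pdf x ((s ^+ 2)%:M)))//; first last.
- by move=> v; rewrite lee_fin.
- apply/measurable_EFinP; exact: measurableT_comp mg (measurable_coor i).
- by move=> v; exact: gaussian_pdf_ge0.
(* [g] is attached to the factor of index [i]; every other factor is a normal density and integrates
   to 1. *)
pose f j t := (if j == i then g t else 1) * normal_pdf (x 0 j) s t.
transitivity (\int[lebesgue_rV m]_v (\prod_j f j (v 0 j))%:E)%E.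
  apply: eq_integral => v _; rewrite -EFinM gaussian_pdf_scalar//; congr EFin.
  rewrite big_split/=; congr (_ * _).
  by rewrite -big_mkcond/= big_pred1_eq.
rewrite integral_prod_coor.
- rewrite (bigD1 i)//= [X in (_ * X)%E]big1 ?mule1.
    by apply: eq_integral => t _; rewrite /f eqxx.
  move=> j ji; rewrite -[RHS](integral_normal_pdf (x 0 j) s).
  by apply: eq_integral => t _; rewrite /f (negbTE ji) mul1r.
- move=> j; rewrite /f; apply: measurable_funM; last exact: measurable_normal_pdf.
  by case: (j == i).
- move=> j t; rewrite /f mulr_ge0// ?normal_pdf_ge0//.
  by case: (j == i).
Qed.

Lemma gaussian_setT s x : 0 < s -> gaussian x ((s ^+ 2)%:M) setT = 1%E.
Proof.
move=> s0; rewrite /gaussian.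
under eq_integral do rewrite gaussian_pdf_scalar//.
rewrite (integral_prod_coor (f := fun i => normal_pdf (x 0 i) s)).
- by rewrite big1// => i _; exact: integral_normal_pdf.
- by move=> i; exact: measurable_normal_pdf.
- by move=> i t; exact: normal_pdf_ge0.
Qed.

Lemma gaussian_coor s x i (B : set R) : 0 < s -> measurable B ->
  gaussian x ((s ^+ 2)%:M) [set v : 'rV[R]_m | B (v 0 i)] = normal_prob (x 0 i) s B.
Proof.
move=> s0 mB; set A := [set v | _].
have mA : measurable A by rewrite -[A]setTI; exact: measurable_coor.
transitivity (\int[gaussian x ((s ^+ 2)%:M)]_v (\1_B (v 0 i))%:E)%E.
  transitivity (\int[gaussian x ((s ^+ 2)%:M)]_v (\1_A v)%:E)%E.
    by rewrite integral_indic// setIT.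
  apply: eq_integral => v _; rewrite !indicE.
  by have -> : (v \in A) = (v 0 i \in B) by apply/idP/idP; rewrite !in_setE.
rewrite integral_gaussian_coor// /normal_prob [RHS]integral_mkcond.
apply: eq_integral => t _; rewrite patchE indicE.
by case: (t \in B); rewrite ?mul1r ?mul0r.
Qed.

(** The integrand is dominated by [Num.sqrt 2 * s] times a normal density of the larger deviation
    [Num.sqrt 2 * s], which has mass 1; the exact first absolute moment is never computed. *)
Lemma integral_abs_normal s (a : R) : 0 < s ->
  (\int[lebesgue_measure]_t (`|t - a| * normal_pdf a s t)%:E <=
   (Num.sqrt 2 * s)%:E)%E.
Proof.
move=> s0.
have s_neq0 : s != 0 by rewrite gt_eqF.
have r20 : 0 < Num.sqrt 2 :> R by rewrite sqrtr_gt0.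
have s2_gt0 : 0 < Num.sqrt 2 * s by rewrite mulr_gt0.
have sqE : (Num.sqrt 2 * s) ^+ 2 = 2 * s ^+ 2 by rewrite exprMn sqr_sqrtr.
apply: (@le_trans _ _ (\int[lebesgue_measure]_t
   ((Num.sqrt 2 * s)%:E * (normal_pdf a (Num.sqrt 2 * s) t)%:E))%E); last first.
  rewrite ge0_integralZl_EFin//.
  - by rewrite integral_normal_pdf mule1.
  - by move=> t _; rewrite lee_fin normal_pdf_ge0.
  - by apply/measurable_EFinP; exact: measurable_normal_pdf.
  - exact: ltW.
apply: ge0_le_integral => //.
- by move=> t _; rewrite lee_fin mulr_ge0// normal_pdf_ge0.
- apply/measurable_EFinP; apply: measurable_funM; last exact: measurable_normal_pdf.
  by apply: measurableT_comp => //; exact: measurable_funB.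
- apply/measurable_EFinP; apply: measurable_funM => //.
  exact: measurable_normal_pdf.
move=> t _; rewrite -EFinM lee_fin !normal_pdfE ?gt_eqF//.
(* [u <= u ^+ 2 / 4 + 1 <= expR (u ^+ 2 / 4)] with [u := `|t - a| / s] *)
set u := `|t - a| / s.
have u0 : 0 <= u by rewrite divr_ge0// ltW.
have uE : (t - a) ^+ 2 = s ^+ 2 * u ^+ 2.
  by rewrite /u exprMn exprVn real_normK ?num_real// mulrCA divff ?mulr1// expf_neq0.
have ule : u <= expR (u ^+ 2 / 4).
  apply: le_trans (expR_ge1Dx _).
  by rewrite -subr_ge0; have -> : 1 + u ^+ 2 / 4 - u = (1 - u / 2) ^+ 2;
    [by field|rewrite sqr_ge0].
have -> : `|t - a| = s * u by rewrite /u mulrCA divff// mulr1.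
have peakE : normal_peak s = Num.sqrt 2 * normal_peak (Num.sqrt 2 * s).
  rewrite /normal_peak sqE.
  have -> : 2 * s ^+ 2 * pi *+ 2 = 2 * (s ^+ 2 * pi *+ 2) by rewrite -mulrA mulrnAr.
  rewrite sqrtrM// invfM mulrA.
  by rewrite divff ?mul1r// gt_eqF.
have funE : expR (u ^+ 2 / 4) * normal_fun a s t = normal_fun a (Num.sqrt 2 * s) t.
  rewrite /normal_fun sqE uE -expRD; congr expR.
  by field.
rewrite -funE peakE.
have sp0 : 0 <= s * (Num.sqrt 2 * normal_peak (Num.sqrt 2 * s)) * normal_fun a s t.
  rewrite mulr_ge0 ?normal_fun_ge0// mulr_ge0 ?ltW//.
  by rewrite mulr_gt0// normal_peak_gt0// gt_eqF.
have := ler_wpM2l sp0 ule.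
by congr (_ <= _); ring.
Qed.

Lemma measurable_fun_norm1B d (T : measurableType d) (f g : T -> 'rV[R]_m) :
  measurable_fun setT f -> measurable_fun setT g ->
  measurable_fun setT (fun t => norm1 (f t - g t)).
Proof.
move=> mf mg; apply: measurable_sum => i; apply: measurableT_comp => //.
apply: (eq_measurable_fun (fun t => f t 0 i - g t 0 i)).
  by move=> t _; rewrite !mxE.
by apply: measurable_funB; exact: measurableT_comp (measurable_coor i) _.
Qed.

Lemma norm1_ge0 v : 0 <= norm1 v.
Proof. by apply: sumr_ge0. Qed.

Lemma integral_norm1_gaussian s x : 0 < s ->
  (\int[gaussian x ((s ^+ 2)%:M)]_v (norm1 (v - x))%:E <=
   (m%:R * (Num.sqrt 2 * s))%:E)%E.
Proof.
move=> s0; under eq_integral => v _ do rewrite /norm1 -sumEFin.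
have mi i : measurable_fun setT (fun v : 'rV[R]_m => `|v 0 i - x 0 i|).
  apply: measurableT_comp => //; apply: measurable_funB => //.
  exact: measurable_coor.
rewrite ge0_integral_sum//; last first.
  move=> i; apply/measurable_EFinP; apply: (eq_measurable_fun _ _ (mi i)).
  by move=> v _; rewrite !mxE.
apply: (@le_trans _ _ (\sum_(i < m) (Num.sqrt 2 * s)%:E)%E); last first.
  by rewrite sumEFin sumr_const card_ord mulr_natl.
apply: lee_sum => i _.
apply: le_trans (integral_abs_normal (x 0 i) s0).
rewrite -(integral_gaussian_coor x i (g := fun t => `|t - x 0 i|))//.
  by under eq_integral => v _ do rewrite !mxE.
by apply: measurableT_comp => //; exact: measurable_funB.
Qed.

(** One coordinate without atoms is what the quantile construction of transport maps requires. *)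
Lemma gaussian_hyperplane s x i c : 0 < s ->
  gaussian x ((s ^+ 2)%:M) [set v : 'rV[R]_m | v 0 i = c] = 0%E.
Proof.
move=> s0; rewrite (gaussian_coor x i (B := [set c]))//.
by rewrite /normal_prob integral_set1.
Qed.

End scalar_gaussian.

(** * Borel sets of row vectors *)

Section rV_topology.
Context {R : realType} {m : nat}.
Implicit Types (x v : 'rV[R]_m) (A : set 'rV[R]_m).

Lemma ler_coor_norm1 v i : `|v 0 i| <= norm1 v.
Proof. by rewrite /norm1 (bigD1 i)//= lerDl sumr_ge0. Qed.

Lemma norm1_le v c : (forall i, `|v 0 i| <= c) -> norm1 v <= m%:R * c.
Proof.
move=> vc; rewrite mulr_natl -{2}(card_ord m) -sumr_const.
by apply: ler_sum => i _; exact: vc.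
Qed.

Lemma norm1D v w : norm1 (v + w) <= norm1 v + norm1 w.
Proof.
by rewrite -big_split/=; apply: ler_sum => i _; rewrite mxE ler_normD.
Qed.

Lemma norm1N v : norm1 (- v) = norm1 v.
Proof. by apply: eq_bigr => i _; rewrite mxE normrN. Qed.

Lemma norm1_dist v w : norm1 (v - w) = norm1 (w - v).
Proof. by rewrite -norm1N opprB. Qed.

Lemma norm1_triangle u v w : norm1 (v - w) <= norm1 (v - u) + norm1 (u - w).
Proof. by apply: le_trans (norm1D _ _); rewrite addrA subrK. Qed.

Lemma norm1_0 : norm1 (0 : 'rV[R]_m) = 0.
Proof. by rewrite /norm1 big1// => i _; rewrite mxE normr0. Qed.

Lemma open_norm1 A v : open A -> A v ->
  exists2 r : R, 0 < r & forall w, norm1 (w - v) < r -> A w.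
Proof.
move=> oA Av; have /nbhs_ballP[r /= r0 rA] : nbhs v A by exact: open_nbhs_nbhs.
exists r => // w wv; apply: rA; split => // i j.
rewrite ord1 /ball/= distrC.
by apply: le_lt_trans wv; have := ler_coor_norm1 (w - v) j; rewrite !mxE.
Qed.

Lemma norm1_open A : (forall v, A v ->
  exists2 r : R, 0 < r & forall w, norm1 (w - v) < r -> A w) -> open A.
Proof.
move=> h; rewrite openE => v /h[r r0 rA]; apply/nbhs_ballP.
(* The l1 norm is at most [m] times the sup norm; dividing by [m.+1] makes the bound strict and
   covers [m = 0]. *)
exists (r / m.+1%:R) => /=; first by rewrite divr_gt0.
move=> w [_ vw]; apply: rA.
apply: (@le_lt_trans _ _ (m%:R * (r / m.+1%:R))).
  apply: norm1_le => i.
  by have := vw 0 i; rewrite /ball/= !mxE distrC => /ltW.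
by rewrite mulrCA gtr_pMr// ltr_pdivrMr// mul1r ltr_nat.
Qed.

Lemma measurable_norm1_box (c : 'rV[R]_m) (r : R) :
  measurable [set v : 'rV[R]_m | forall i, `|v 0 i - c 0 i| < r].
Proof.
rewrite (_ : [set _ | _] = \bigcap_(i in [set: 'I_m])
  [set v : 'rV[R]_m | `|v 0 i - c 0 i| < r]); last first.
  by apply/seteqP; split => v /= h i; [move=> _|]; exact: h.
apply: fin_bigcap_measurable => // i _.
have mi : measurable_fun setT (fun v : 'rV[R]_m => `|v 0 i - c 0 i|).
  apply: measurableT_comp => //; apply: measurable_funB => //.
  exact: measurable_coor.
have := mi measurableT `]-oo, r[%classic (measurable_itv _).
by rewrite setTI; congr measurable; apply/seteqP; split => v /=; rewrite in_itv.
Qed.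

(** The sigma-algebra comes from the coordinates, so an open set is written as the countable union
    of the boxes with rational centre and radius [k.+1%:R^-1] that it contains. *)
Lemma open_measurable_rV A : open A -> measurable A.
Proof.
move=> oA.
pose box (z : 'rV[rat]_m * nat) := [set v : 'rV[R]_m |
  forall i, `|v 0 i - (map_mx ratr z.1 : 'rV[R]_m) 0 i| < z.2.+1%:R^-1].
rewrite (_ : A = \bigcup_(z in setT) (if `[< box z `<=` A >] then box z else set0)).
  apply: countable_bigcupT_measurable; first exact: countableP.
  move=> z; case: asboolP => _; last exact: measurable0.
  exact: measurable_norm1_box.
apply/seteqP; split=> [v Av|v [z _]]; last by case: asboolP => // h /h.
have [r r0 rA] := open_norm1 oA Av.
(* The factor 2 pays for two displacements: from [v] to the rational centre, and from there to
   [w]. *)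
have d0 : 0 < r / (2 * m.+1%:R) by rewrite divr_gt0// mulr_gt0.
have [k kr] : exists k : nat, k.+1%:R^-1 < r / (2 * m.+1%:R).
  exists (Num.truncn ((r / (2 * m.+1%:R))^-1)).
  by rewrite invf_plt ?posrE// truncnS_gt.
have k0 : 0 < k.+1%:R^-1 :> R by rewrite invr_gt0.
have hq i : exists q : rat, `|v 0 i - ratr q| < k.+1%:R^-1.
  have /rat_in_itvoo[q] : v 0 i - k.+1%:R^-1 < v 0 i + k.+1%:R^-1.
    by rewrite ltrBlDr -addrA ltrDl addr_gt0.
  rewrite in_itv/= => /andP[]; move: (k.+1%:R^-1) => e q1 q2; exists q.
  by rewrite ltr_norml; apply/andP; split; lra.
have [q qv] := choice hq.
exists (\row_i q i, k) => //; case: asboolP => [_ i|[]] /=.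
  by rewrite !mxE; exact: qv.
move=> w wq; apply: rA.
apply: (@le_lt_trans _ _ (m%:R * (r / m.+1%:R))).
  apply: norm1_le => i.
  rewrite !mxE; have /= := wq i; rewrite !mxE => wqi; have qvi := qv i.
  have -> : r / m.+1%:R = r / (2 * m.+1%:R) + r / (2 * m.+1%:R).
    by rewrite [LHS]splitr [in RHS]invfM [in RHS]mulrA [in RHS]mulrAC.
  rewrite (_ : w 0 i - v 0 i = (w 0 i - ratr (q i)) - (v 0 i - ratr (q i))).
    apply: le_trans (ler_normB _ _) _; rewrite lerD// ltW//.
    - exact: lt_trans kr.
    - exact: lt_trans kr.
  by lra.
by rewrite mulrCA gtr_pMr// ltr_pdivrMr// mul1r ltr_nat.
Qed.

Lemma compact_measurable_rV A : compact A -> measurable A.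
Proof.
move=> cA; rewrite -[A]setCK; apply: measurableC; apply: open_measurable_rV.
rewrite openC; apply: compact_closed => //; exact: norm_hausdorff.
Qed.

Lemma compact_norm1_bounded A : compact A ->
  exists2 M : R, 0 < M & forall v, A v -> norm1 v <= M.
Proof.
move=> /compact_bounded[M [_ /(_ (`|M| + 1))]].
move=> /(_ _)/wrap[]; first by rewrite (le_lt_trans (ler_norm _))// ltrDl.
move=> h; exists (m.+1%:R * (`|M| + 1)) => [|v Av].
  by rewrite mulr_gt0// ltr_wpDl.
have /= vM := h _ Av.
apply: (@le_trans _ _ (m%:R * (`|M| + 1))); last first.
  by rewrite ler_wpM2r ?addr_ge0// ler_nat.
apply: norm1_le => i.
apply: le_trans vM; rewrite [leRHS]/Num.norm/= mx_normrE.
by rewrite (le_trans _ (le_bigmax _ _ (0, i))).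
Qed.

(** Each strict sublevel set is the trace on [A] of the open set [O], a union of l1 balls around
    points [y] of [A] on which the Lipschitz bound keeps the value below [c]. The slope [K + 1] is
    positive even when [K = 0], so the radii are well defined. *)
Lemma lipschitz_measurable A (g : 'rV[R]_m -> R) (K : R) : measurable A ->
  0 <= K -> (forall x y, A x -> A y -> `|g x - g y| <= K * norm1 (x - y)) ->
  measurable_fun A g.
Proof.
move=> mA K0 gK; apply: (measurability _ (RGenInftyO.measurableE R)) => //.
move=> _ [_ [c ->] <-].
pose O := [set w | exists2 y, A y /\ g y < c & (K + 1) * norm1 (w - y) < c - g y].
have -> : A `&` g @^-1` `]-oo, c[ = A `&` O.
  apply/seteqP; split => [w [Aw]|w [Aw [y [Ay gy] wy]]]; rewrite /= in_itv/=.
    by move=> gw; split=> //; exists w => //; rewrite subrr norm1_0 mulr0 subr_gt0.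
  split => //; have := gK _ _ Aw Ay; have := ler_norm (g w - g y).
  have := norm1_ge0 (w - y).
  rewrite mulrDl mul1r in wy; lra.
apply: measurableI => //; apply: open_measurable_rV; apply: norm1_open.
move=> w [y [Ay gy] wy]; have K10 : 0 < K + 1 by rewrite ltr_wpDl.
exists ((c - g y) / (K + 1) - norm1 (w - y)).
  by rewrite subr_gt0 ltr_pdivlMr// mulrC.
move=> w' h; exists y => //.
rewrite mulrC -ltr_pdivlMr//; apply: le_lt_trans (norm1_triangle w _ _) _.
by rewrite -ltrBrDr.
Qed.

End rV_topology.

Lemma measure_mono d (T : measurableType d) (R : realType)
    (mu : {measure set T -> \bar R}) (A B : set T) :
  measurable A -> measurable B -> A `<=` B -> (mu A <= mu B)%E.
Proof. by move=> mA mB AB; exact: le_measure (mem_set mA) (mem_set mB) AB. Qed.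

(** * Gaussian averages at almost every point *)

Section eventually_small.
Context {R : realType}.
Local Open Scope ereal_scope.

(** For nonnegative sequences this is convergence to 0, in a form stable under domination and sums
    without finiteness conditions. *)
Definition vanishes (u : nat -> \bar R) :=
  forall e : R, (0 < e)%R -> \forall n \near \oo, u n <= e%:E.

Lemma vanishes_le (u v : nat -> \bar R) :
  (\forall n \near \oo, u n <= v n) -> vanishes v -> vanishes u.
Proof.
by move=> uv v0 e e0; near=> n; apply: (@le_trans _ _ (v n)); near: n => //; exact: v0.
Unshelve. all: by end_near. Qed.

Lemma vanishesD (u v : nat -> \bar R) :
  vanishes u -> vanishes v -> vanishes (fun n => u n + v n).
Proof.
move=> u0 v0 e e0; have e20 : (0 < e / 2)%R by rewrite divr_gt0.
near=> n; rewrite (splitr e) EFinD; apply: leeD; near: n; [exact: u0|exact: v0].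
Unshelve. all: by end_near. Qed.

Lemma cvg0_vanishes (u : nat -> \bar R) : u @ \oo --> 0 -> vanishes u.
Proof.
move=> /fine_cvgP[ufin /cvgrPdist_le u0] e e0; near=> n.
rewrite -[u n]fineK; last by near: n.
rewrite lee_fin (le_trans (ler_norm _))//.
by rewrite -normrN -[X in `|X|%R]add0r; near: n; exact: u0.
Unshelve. all: by end_near. Qed.

Lemma vanishes_cvg0 (u : nat -> \bar R) : (forall n, 0 <= u n) ->
  vanishes u -> u @ \oo --> 0.
Proof.
move=> u_ge0 u0; apply/fine_cvgP; split.
  near=> n; rewrite ge0_fin_numE//.
  by apply: (@le_lt_trans _ _ 1%:E); [near: n; exact: u0|rewrite ltry].
apply/cvgrPdist_le => e e0; near=> n.
rewrite sub0r normrN ger0_norm/=; last by rewrite fine_ge0.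
rewrite -lee_fin fineK; first by near: n; exact: u0.
rewrite ge0_fin_numE//.
by apply: (@le_lt_trans _ _ 1%:E); [near: n; exact: u0|rewrite ltry].
Unshelve. all: by end_near. Qed.

Lemma vanishes_Minvn (c : R) : vanishes (fun n => (c * n.+1%:R^-1)%:E).
Proof.
move=> e e0; near=> n; rewrite lee_fin ler_pdivrMr//.
rewrite mulrC -ler_pdivrMr//.
apply: (@le_trans _ _ n%:R); last by rewrite ler_nat.
near: n; exact: nbhs_infty_ger.
Unshelve. all: by end_near. Qed.

End eventually_small.

Section gaussian_approximation.
Context {R : realType} {m : nat}.
Local Open Scope ereal_scope.
Local Notation lam := (lebesgue_rV m).
Implicit Types (x v : 'rV[R]_m) (A B : set 'rV[R]_m).

Definition sgauss (s : R) x : {measure set 'rV[R]_m -> \bar R} :=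
  gaussian x ((s ^+ 2)%:M).

Lemma sgauss_setT s x : (0 < s)%R -> sgauss s x setT = 1.
Proof. exact: gaussian_setT. Qed.

Lemma sgauss_le1 s x A : (0 < s)%R -> measurable A -> sgauss s x A <= 1.
Proof.
move=> s0 mA; rewrite -(sgauss_setT x s0).
exact: measure_mono.
Qed.

Lemma sgaussC s x A : (0 < s)%R -> measurable A ->
  sgauss s x A = 1 - sgauss s x (~` A).
Proof.
move=> s0 mA; rewrite -(sgauss_setT x s0) -(setUv A) measureU//; last first.
- by rewrite setICr.
- exact: measurableC.
rewrite addeK// ge0_fin_numE//.
by rewrite (le_lt_trans (sgauss_le1 x s0 (measurableC mA)))// ltry.
Qed.

Lemma measurable_gaussian_pdf2 s : (0 < s)%R ->
  measurable_fun setT (fun z : 'rV[R]_m * 'rV[R]_m =>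
    gaussian_pdf z.1 ((s ^+ 2)%:M) z.2).
Proof.
move=> s0; apply: (eq_measurable_fun (fun z : 'rV[R]_m * 'rV[R]_m =>
    \prod_i (normal_peak s * normal_fun 0 s (z.2 0%R i - z.1 0%R i))))%R.
  move=> z _; rewrite gaussian_pdf_scalar//; apply: eq_bigr => i _.
  by rewrite normal_pdfE ?gt_eqF// /normal_fun subr0.
apply: measurable_prod => i _; apply: measurable_funM => //.
apply: measurableT_comp; first exact: measurable_normal_fun.
apply: measurable_funB.
  exact: measurableT_comp (measurable_coor i) measurable_snd.
exact: measurableT_comp (measurable_coor i) measurable_fst.
Qed.

Let gker s A B (z : 'rV[R]_m * 'rV[R]_m) : \bar R :=
  ((\1_A z.1)%:E * (gaussian_pdf z.1 ((s ^+ 2)%:M) z.2)%:E) * (\1_B z.2)%:E.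

Let gker_ge0 s A B z : 0 <= gker s A B z.
Proof. by rewrite !mule_ge0// lee_fin gaussian_pdf_ge0. Qed.

Let measurable_gker s A B : (0 < s)%R -> measurable A -> measurable B ->
  measurable_fun setT (gker s A B).
Proof.
move=> s0 mA mB; apply: emeasurable_funM.
  apply: emeasurable_funM; apply/measurable_EFinP.
    exact: measurableT_comp (measurable_indic mA) measurable_fst.
  exact: measurable_gaussian_pdf2.
by apply/measurable_EFinP; exact: measurableT_comp (measurable_indic mB) measurable_snd.
Qed.

Let sgaussE s x B : measurable B ->
  sgauss s x B = \int[lam]_v ((gaussian_pdf x ((s ^+ 2)%:M) v)%:E * (\1_B v)%:E).
Proof.
move=> mB; rewrite /sgauss/= /gaussian integral_mkcond; apply: eq_integral => v _.
by rewrite patchE indicE; case: (v \in B); rewrite ?mule1 ?mule0.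
Qed.

Lemma measurable_sgauss s B : (0 < s)%R -> measurable B ->
  measurable_fun setT (fun x => sgauss s x B).
Proof.
move=> s0 mB.
have /= := measurable_fun_fubini_tonelli_F (m2 := lam)
  _ (measurable_gker s0 measurableT mB) (gker_ge0 s setT B).
apply: eq_measurable_fun => x _; rewrite /fubini_F sgaussE//.
by apply: eq_integral => v _; rewrite /gker/= indicT mul1e.
Qed.

(** Both sides integrate the symmetric Gaussian kernel over the product of [A] and [B], in the two
    orders of Tonelli. *)
Lemma sgauss_sym s A B : (0 < s)%R -> measurable A -> measurable B ->
  \int[lam]_(x in A) sgauss s x B = \int[lam]_(x in B) sgauss s x A.
Proof.
move=> s0 mA mB.
have mg C x : measurable C -> measurable_fun setT (fun v =>
    (gaussian_pdf x ((s ^+ 2)%:M) v)%:E * (\1_C v)%:E).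
  move=> mC; apply: emeasurable_funM; apply/measurable_EFinP.
    exact: measurable_gaussian_pdf.
  exact: measurable_indic.
have intE C D : measurable C -> measurable D ->
    \int[lam]_(x in C) sgauss s x D =
    \int[lam]_x ((\1_C x)%:E * \int[lam]_v ((gaussian_pdf x ((s ^+ 2)%:M) v)%:E * (\1_D v)%:E)).
  move=> mC mD; rewrite integral_mkcond; apply: eq_integral => x _.
  by rewrite patchE indicE -sgaussE//; case: (x \in C); rewrite ?mul1e ?mul0e.
have mk := measurable_gker s0 mA mB.
have EF : \int[lam]_(x in A) sgauss s x B =
    \int[lam]_x fubini_F lam (gker s A B) x.
  rewrite (intE A B mA mB); apply: eq_integral => x _.
  rewrite /fubini_F -ge0_integralZl_EFin//.
  - by apply: eq_integral => v _; rewrite /gker muleA.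
  - by move=> v _; rewrite mule_ge0// lee_fin gaussian_pdf_ge0.
  - exact: mg.
have EG : \int[lam]_(x in B) sgauss s x A =
    \int[lam]_x fubini_G lam (gker s A B) x.
  rewrite (intE B A mB mA); apply: eq_integral => x _.
  rewrite /fubini_G -ge0_integralZl_EFin//.
  - apply: eq_integral => v _; rewrite /gker/= gaussian_pdf_sym//.
    by rewrite [LHS]muleC; congr (_ * _); rewrite muleC.
  - by move=> v _; rewrite mule_ge0// lee_fin gaussian_pdf_ge0.
  - exact: mg.
rewrite EF EG.
have gk0 := gker_ge0 s A B.
by rewrite -(fubini_tonelli1 (m1 := lam) (m2 := lam) _ mk gk0)
  -(fubini_tonelli2 (m1 := lam) (m2 := lam) _ mk gk0).
Qed.

(** Markov's inequality applied to the l1 distance from the centre. *)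
Lemma sgauss_far s x A (r : R) : (0 < s)%R -> (0 < r)%R -> measurable A ->
  (forall v, A v -> r <= norm1 (v - x))%R ->
  sgauss s x A <= (r^-1 * (m%:R * Num.sqrt 2) * s)%:E.
Proof.
move=> s0 r0 mA Ar.
have h : r%:E * sgauss s x A <= (m%:R * (Num.sqrt 2 * s))%:E.
  apply: le_trans (integral_norm1_gaussian x s0).
  rewrite -integral_cst//.
  apply: (@le_trans _ _ (\int[sgauss s x]_(v in A) (norm1 (v - x))%:E)).
    apply: ge0_le_integral => //.
    - by move=> v _; rewrite lee_fin ltW.
    - apply/measurable_EFinP; apply: measurable_funTS.
      exact: measurable_fun_norm1B.
  apply: ge0_subset_integral => //.
  - apply/measurable_EFinP; exact: measurable_fun_norm1B.
  - by move=> v _; rewrite lee_fin norm1_ge0.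
have : sgauss s x A \is a fin_num.
  by rewrite ge0_fin_numE// (le_lt_trans (sgauss_le1 x s0 mA))// ltry.
move: h => /[swap] /fineK <-; rewrite -EFinM !lee_fin => h.
by rewrite -mulrA ler_pdivlMl// -mulrA.
Qed.

Lemma sgauss_open A x : open A -> A x ->
  vanishes (fun n => sgauss n.+1%:R^-1 x (~` A)).
Proof.
move=> oA Ax; have [r r0 rA] := open_norm1 oA Ax.
apply: (vanishes_le _ (vanishes_Minvn (r^-1 * (m%:R * Num.sqrt 2)))).
apply: nearW => n; apply: sgauss_far => //.
- by apply: measurableC; exact: open_measurable_rV.
- by move=> v nAv; rewrite leNgt; apply/negP => /rA.
Qed.

(* The kernel being symmetric and of mass one, this is half the L1 distance
   between the indicator of [A] and its Gaussian average. *)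
Definition leak n A := \int[lam]_(x in A) sgauss n.+1%:R^-1 x (~` A).

Let sn_gt0 n : (0 < n.+1%:R^-1 :> R)%R. Proof. by rewrite invr_gt0. Qed.
Local Hint Resolve sn_gt0 : core.

Let msg n A D : measurable A -> measurable_fun D (fun x => sgauss n.+1%:R^-1 x A).
Proof. by move=> mA; apply: measurable_funTS; exact: measurable_sgauss. Qed.

(** From a point of an open set the escaping mass tends to 0; it is at most 1 and [A] has finite
    measure, so dominated convergence applies. *)
Lemma leak_open A : open A -> lam A < +oo -> vanishes (leak ^~ A).
Proof.
move=> oA Afin; have mA := open_measurable_rV oA.
apply: cvg0_vanishes.
have := @dominated_convergence _ _ _ lam A mA
  (fun n x => sgauss n.+1%:R^-1 x (~` A)) (cst 0) (cst 1).
rewrite integral0 => -[].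
- by move=> n; apply: msg; exact: measurableC.
- by [].
- apply: nearW => x Ax; apply: vanishes_cvg0 => //.
  exact: sgauss_open.
- apply/integrableP; split => //.
  rewrite (eq_integral (cst 1)) => [|x _]; last by rewrite /= normr1.
  by rewrite integral_cst// mul1e.
- apply: nearW => x n Ax; rewrite gee0_abs//.
  by apply: sgauss_le1 => //; exact: measurableC.
- by [].
Qed.

(** Mass leaving [A \ B] leaves [A] or enters [B]. By symmetry, the mass passing from [A \ B] into
    [B] equals that passing from [B] into [A \ B], which is part of the leak of [B]. *)
Lemma leak_setD n A B : measurable A -> measurable B -> B `<=` A ->
  leak n (A `\` B) <= leak n A + leak n B.
Proof.
move=> mA mB BA; have mD := measurableD mA mB.
have mAC := measurableC mA; have mBC := measurableC mB.
apply: (@le_trans _ _ (\int[lam]_(x in A `\` B)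
    (sgauss n.+1%:R^-1 x (~` A) + sgauss n.+1%:R^-1 x B))).
  apply: ge0_le_integral => //.
  - by apply: msg; exact: measurableC.
  - by apply: emeasurable_funD; exact: msg.
  - move=> x _; rewrite setDE setCI setCK; exact: measureU2.
rewrite ge0_integralD//; [|exact: msg|exact: msg].
apply: leeD.
  apply: ge0_subset_integral => //; exact: msg.
have -> : \int[lam]_(x in A `\` B) sgauss n.+1%:R^-1 x B =
    \int[lam]_(x in B) sgauss n.+1%:R^-1 x (A `\` B) by exact: sgauss_sym.
apply: ge0_le_integral => //; [exact: msg|exact: msg|].
by move=> x _; apply: measure_mono => //; exact: subDsetr.
Qed.

(** Starting points in [F k] leak out of the union no more than out of [F k]; the remaining ones
    contribute at most their Lebesgue measure, the kernel having mass one. *)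
Lemma leak_bigcup (F : nat -> set 'rV[R]_m) n k :
  (forall i, measurable (F i)) ->
  leak n (\bigcup_i F i) <= leak n (F k) + lam (\bigcup_i F i `\` F k).
Proof.
move=> mF; set A := \bigcup_i F i.
have mA : measurable A by exact: bigcupT_measurable.
have FA : F k `<=` A by exact: bigcup_sup.
have mD := measurableD mA (mF k); have mAC := measurableC mA.
have mFC := measurableC (mF k).
have -> : leak n A = \int[lam]_(x in F k) sgauss n.+1%:R^-1 x (~` A) +
    \int[lam]_(x in A `\` F k) sgauss n.+1%:R^-1 x (~` A).
  rewrite -ge0_integral_setU//.
  - by rewrite setDUK.
  - exact: msg.
  - by rewrite disj_set2E setDIK.
apply: leeD.
  apply: ge0_le_integral => //; [exact: msg|exact: msg|].
  by move=> x _; apply: measure_mono => //; exact: subsetC.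
rewrite -[leRHS]mul1e -integral_cst//.
apply: ge0_le_integral => //; [exact: msg|].
by move=> x _; exact: sgauss_le1.
Qed.

(** Bounded windows give the finite measure that dominated convergence needs. The subtraction of the
    zero vector keeps a cube an instance of [measurable_norm1_box]. *)
Definition cube (k : nat) := [set v : 'rV[R]_m |
  forall i, (`|v 0%R i - (0 : 'rV[R]_m) 0%R i| < k.+1%:R)%R].

Let open_cube k : open (cube k).
Proof.
apply: norm1_open => v vk.
suff [r r0 hr] : exists2 r : R, (0 < r)%R & forall i, (`|v 0%R i - (0 : 'rV[R]_m) 0%R i| + r <= k.+1%:R)%R.
  exists r => // w wv i; have := hr i; rewrite !mxE !subr0 => hri.
  have := ler_normD (w 0%R i - v 0%R i)%R (v 0%R i); rewrite subrK => h1.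
  have := ler_coor_norm1 (w - v)%R i; rewrite !mxE => h2.
  by apply: (le_lt_trans h1); move: h2 wv hri; move: (k.+1%:R : R)%R => K; lra.
(* The default value 1 keeps this minimum positive and covers [m = 0]. *)
exists (\big[Num.min/1]_i (k.+1%:R - `|v 0 i - (0 : 'rV[R]_m) 0 i|))%R.
  by apply/bigmin_gtP; split=> // i _; rewrite subr_gt0.
by move=> i; rewrite addrC -lerBrDr; apply: bigmin_le_cond.
Qed.

Let cube_fin k : lam (cube k) < +oo.
Proof.
have mb : measurable (cube k) by exact: measurable_norm1_box.
pose I := `](- k.+1%:R)%R, (k.+1%:R : R)[%classic.
have -> : lam (cube k) = \int[lam]_v (\prod_i \1_I (v 0%R i))%:E.
  rewrite -[cube k]setIT -integral_indic//; apply: eq_integral => v _.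
  rewrite indicE; congr EFin; case: (boolP (v \in cube k)) => [/set_mem vk|].
    rewrite big1// => i _; rewrite indicE mem_set// /I/= in_itv/=.
    by have := vk i; rewrite mxE subr0 ltr_norml.
  move/negP => vk; apply/esym/eqP/prodf_eq0.
  apply: contrapT => h; apply: vk; apply/mem_set => i; rewrite mxE subr0.
  apply: contrapT => vi; apply: h; exists i => //.
  rewrite indicE memNset// /I/= in_itv/= => vi'; apply: vi.
  by rewrite ltr_norml.
rewrite (integral_prod_coor (f := fun=> \1_I))//; last first.
  by move=> _; apply: measurable_indic; exact: measurable_itv.
rewrite (eq_bigr (fun=> (k.+1%:R - - k.+1%:R)%:E)).
  by rewrite prodEFin ltry.
move=> i _; rewrite integral_indic//=; last exact: measurable_itv.
rewrite setIT lebesgue_measure_itv/= lte_fin.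
by rewrite gtrN// EFinB.
Qed.

(* Sets with vanishing leak contain the open sets, by dominated convergence, and
   form a lambda-system, thanks to the symmetry of the kernel. *)
Lemma leak_vanishes A k : measurable A -> vanishes (leak ^~ (A `&` cube k)).
Proof.
set Q := cube k; have mQ : measurable Q by exact: measurable_norm1_box.
pose H := [set A : set 'rV[R]_m | measurable A /\ vanishes (leak ^~ (A `&` Q))].
pose G := [set A : set 'rV[R]_m | open A].
suff : <<s G >> `<=` H.
  move=> GH mA; have [] // : H A; apply: GH.
  move: mA; apply: smallest_sub; first exact: smallest_sigma_algebra.
  rewrite -bigcup_seq => _ [i _ [B mB <-]].
  (* The coordinates are continuous, hence measurable for the sigma-algebra generated by the open
     sets, which therefore contains every measurable set. *)
  pose T := g_sigma_algebraType G.
  suff mi : measurable_fun [set: T] (fun v : T => (v : 'rV[R]_m) 0%R i : R).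
    exact: (mi measurableT).
  apply: (measurability _ (RGenOpens.measurableE R)) => //.
  move=> _ [_ [a [b ->]] <-]; apply: sub_sigma_algebra; rewrite setTI /G/=.
  apply: (@open_comp _ _ (fun v : 'rV[R]_m => v 0%R i)); last exact: interval_open.
  by move=> v _; exact: coord_continuous.
apply: lambda_system_subset => //.
- by move=> B C oB oC; exact: openI.
- split.
  + by move=> B _ v _.
  + split; first exact: measurableT.
    by rewrite setTI; apply: leak_open; [exact: open_cube|exact: cube_fin].
  + move=> B C CB [mB hB] [mC hC]; split; first exact: measurableD.
    have -> : (B `\` C) `&` Q = (B `&` Q) `\` (C `&` Q).
      apply/seteqP; split=> v /=; first by move=> [[Bv nCv] Qv]; split=> // -[].
      by move=> [[Bv Qv] nCQ]; split=> //; split=> // Cv; exact: nCQ.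
    apply: vanishes_le (vanishesD hB hC); apply: nearW => n.
    by apply: leak_setD; [exact: measurableI|exact: measurableI|exact: setSI].
  + move=> F ndF HF; have mF i := (HF i).1.
    split; first exact: bigcupT_measurable.
    rewrite setI_bigcupl => e e0.
    have mFQ i : measurable (F i `&` Q) by exact: measurableI.
    (* The remainders decrease to the empty set inside a cube of finite measure, so one index [j]
       makes the measure at most [e / 2]; the leak of [F j] within the cube then takes the other
       half. *)
    pose D k := \bigcup_i (F i `&` Q) `\` (F k `&` Q).
    have mU : measurable (\bigcup_i (F i `&` Q)) by exact: bigcupT_measurable.
    have mD i : measurable (D i) by exact: measurableD.
    have /cvg0_vanishes : lam (D k) @[k --> \oo] --> 0.
      rewrite -(measure0 lam).
      have <- : \bigcap_i D i = set0.
        rewrite -subset0 => v Dv; have [[i _ FQv] _] := Dv 0%N I.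
        by have [_ /(_ FQv)] := Dv i I.
      apply: nonincreasing_cvg_mu => //.
      - apply: le_lt_trans (cube_fin k); apply: measure_mono => //.
        by move=> v [[i _ []]].
      - exact: bigcapT_measurable.
      - move=> a b ab; apply/subsetPset => v [Uv nFv]; split=> // -[Fv Qv].
        by apply: nFv; split=> //; have /subsetPset := ndF _ _ ab; exact.
    move=> /(_ (e / 2)%R); rewrite divr_gt0// => /(_ isT)[j _ /(_ j (leqnn _)) hj].
    have [_ /(_ (e / 2)%R)] := HF j; rewrite divr_gt0// => /(_ isT).
    apply: filterS => n hn; rewrite (splitr e) EFinD.
    apply: le_trans (leak_bigcup _ j mFQ) _; exact: leeD.
- move=> B oB; split; first exact: open_measurable_rV.
  apply: leak_open; first by apply: openI => //; exact: open_cube.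
  apply: le_lt_trans (cube_fin k); apply: measure_mono => //.
  exact: measurableI (open_measurable_rV oB) mQ.
Qed.

End gaussian_approximation.

(** * Almost everywhere lower bounds along a subsequence *)

Lemma ge0_integral_markov d (T : measurableType d) (R : realType)
    (mu : {measure set T -> \bar R}) (f : T -> R) (B : set T) (q : R) :
  measurable_fun setT f -> (forall x, 0 <= f x) -> measurable B ->
  0 <= q -> (forall x, B x -> q <= f x) ->
  (q%:E * mu B <= \int[mu]_x (f x)%:E)%E.
Proof.
move=> mf f0 mB q0 qf; rewrite -integral_cst//.
apply: (@le_trans _ _ (\int[mu]_(x in B) (f x)%:E)%E).
  by apply: ge0_le_integral => //; apply/measurable_EFinP; exact: measurable_funTS.
apply: ge0_subset_integral => //; first exact/measurable_EFinP.
by move=> x _; rewrite lee_fin.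
Qed.

Section lower_approximation.
Context {R : realType}.
Local Open Scope ereal_scope.

(** Stage [l] constrains only the finitely many sequences of index at most [l]. The geometric bound
    makes each sequence [j] summable along [phi] from stage [j] on. *)
Lemma diagonal_subsequence (u : nat -> nat -> \bar R) :
  (forall j, vanishes (u j)) ->
  exists phi : nat -> nat, forall l, (l <= phi l)%N /\
    forall j, (j <= l)%N -> u j (phi l) <= (1 / (2 ^ l.+1)%:R)%:E.
Proof.
move=> u0.
suff h l : exists n, (l <= n)%N /\
    forall j, (j <= l)%N -> u j n <= (1 / (2 ^ l.+1)%:R)%:E.
  by have [phi hphi] := choice h; exists phi.
have e0 : (0 < 1 / (2 ^ l.+1)%:R :> R)%R by rewrite divr_gt0// ltr0n expn_gt0.
move: (1 / _)%R e0 => e e0.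
suff [n _ hn] : \forall n \near \oo, (l <= n)%N /\
    forall j, (j < l.+1)%N -> u j n <= e%:E.
  by exists n; exact: hn n (leqnn n).
near=> n; split; first by near: n; exact: nbhs_infty_ge.
near: n; elim: l.+1 => [|k IH]; first by near=> n.
near=> n => j; rewrite ltnS leq_eqVlt => /predU1P[->|].
  by near: n; exact: u0.
by move: j; near: n; exact: IH.
Unshelve. all: by end_near. Qed.

Lemma summable_vanishes (u : nat -> \bar R) : (forall n, 0 <= u n) ->
  \sum_(0 <= n <oo) u n < +oo -> vanishes u.
Proof.
move=> u_ge0 uoo.
apply: vanishes_le (cvg0_vanishes (nneseries_tail_cvg uoo (fun n _ => u_ge0 n))).
apply: nearW => n; apply: le_trans (nneseries_lim_ge n.+1 _) => //.
by rewrite big_nat1.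
Qed.

Context {m : nat}.
Local Notation lam := (lebesgue_rV m).
Implicit Types (x v : 'rV[R]_m) (A B : set 'rV[R]_m).

Let sn_gt0 n : (0 < n.+1%:R^-1 :> R)%R. Proof. by rewrite invr_gt0. Qed.

(** A Borel-Cantelli argument: the leaks are summable, so the series of escaping masses has a finite
    integral over [A]; it converges at almost every point of [A], where its terms must vanish. *)
Lemma ae_sgauss_concentrates (phi : nat -> nat) A j : measurable A ->
  (forall l, (j <= l)%N -> leak (phi l) A <= (1 / (2 ^ l.+1)%:R : R)%:E) ->
  {ae lam, forall x, A x ->
    vanishes (fun l => sgauss (phi l).+1%:R^-1 x (~` A))}.
Proof.
move=> mA leakA; have mAC := measurableC mA.
(* Shifted by [j], since the bounds on the leak are available only from stage [j] on. *)
pose g l x := sgauss (phi (l + j)%N).+1%:R^-1 x (~` A).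
pose F x := \sum_(0 <= l <oo) g l x.
have mg l : measurable_fun A (g l).
  by apply: measurable_funTS; exact: measurable_sgauss.
have g0 l x : A x -> 0 <= g l x by move=> _; exact: measure_ge0.
have F0 x : 0 <= F x by apply: nneseries_ge0 => *; exact: measure_ge0.
have mF : measurable_fun A F by apply: ge0_emeasurable_sum => // l x /g0.
have iF : lam.-integrable A F.
  apply/integrableP; split => //.
  under eq_integral => x _ do rewrite gee0_abs//.
  have -> := @integral_nneseries _ _ _ lam A mA g mg g0.
  apply: (@le_lt_trans _ _ (\sum_(0 <= l <oo) (1 / (2 ^ l.+1)%:R)%:E)).
    apply: lee_nneseries => [l _ _|l _]; first by apply: integral_ge0 => x /g0.
    apply: le_trans (leakA _ (leq_addl _ _)) _.
    rewrite lee_fin !mul1r lef_pV2 ?posrE ?ltr0n ?expn_gt0// ler_nat.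
    by rewrite leq_exp2l// ltnS leq_addr.
  apply: (@le_lt_trans _ _ 1%:E); last exact: ltry.
  exact: (epsilon_trick0 predT).
have := integrable_ae mA iF.
apply: filterS => x FxA Ax; have Fx := FxA Ax.
have hv : vanishes (fun l => sgauss (phi (l + j)%N).+1%:R^-1 x (~` A)).
  apply: summable_vanishes => [l|]; first exact: measure_ge0.
  by move: Fx; rewrite ge0_fin_numE.
move=> e e0; have [k _ hk] := hv e e0; exists (k + j)%N; [exact: I|move=> l /= kl].
have -> : l = (l - j + j)%N by rewrite subnK// (leq_trans (leq_addl _ _) kl).
by apply: hk; rewrite /= leq_subRL ?(leq_trans (leq_addl _ _) kl)// addnC.
Qed.

(** Concentration is applied to the countably many sets where [f] exceeds a rational, cut by cubes.
    If a rational [q] lies between [f x - e] and [f x], nearly all the Gaussian mass around [x]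
    stays where [f] is at least [q]. *)
Lemma ae_sgauss_liminf (f : 'rV[R]_m -> R) : measurable_fun setT f ->
  (forall v, 0 <= f v)%R ->
  exists phi : nat -> nat, (forall l, (l <= phi l)%N) /\
    {ae lam, forall x, forall e : R, (0 < e)%R -> \forall l \near \oo,
      (f x - e)%:E <= \int[sgauss (phi l).+1%:R^-1 x]_v (f v)%:E}.
Proof.
move=> mf f0.
have mfq (q : R) : measurable [set v | (q < f v)%R].
  have := mf measurableT `]q, +oo[%classic (measurable_itv _).
  rewrite setTI; congr measurable; apply/seteqP.
  by split=> v /=; rewrite in_itv/= andbT.
(* The pairs of a rational and a cube are enumerated; codes of no pair give the empty set. *)
pose A j : set 'rV[R]_m := if @choice.unpickle (rat * nat)%type j is Some (q, k)
  then [set v | (ratr q < f v)%R] `&` cube k else set0.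
have mA j : measurable (A j).
  rewrite /A; case: choice.unpickle => [[q k]|]; last exact: measurable0.
  by apply: measurableI => //; exact: measurable_norm1_box.
have leakA j : vanishes (leak ^~ (A j)).
  rewrite /A; case: choice.unpickle => [[q k]|]; first exact: leak_vanishes.
  apply: vanishes_le (vanishes_Minvn 0); apply: nearW => n.
  by rewrite /leak integral_set0 mul0r.
have [phi hphi] := diagonal_subsequence leakA.
exists phi; split; first by move=> l; case: (hphi l).
have : {ae lam, forall x, forall j, A j x ->
    vanishes (fun l => sgauss (phi l).+1%:R^-1 x (~` (A j)))}.
  apply: ae_foralln => j; apply: (@ae_sgauss_concentrates _ _ j) => // l jl.
  by apply: (hphi l).2.
apply: filterS => x hx e e0.
have [fxe|fxe] := ltP (f x - e)%R 0%R.
  apply: nearW => l; apply: (@le_trans _ _ 0); first by rewrite lee_fin ltW.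
  by apply: integral_ge0 => v _; rewrite lee_fin.
have /rat_in_itvoo[q] : (f x - e < f x)%R by rewrite ltrBlDr ltrDl.
rewrite in_itv/= => /andP[q1 q2].
have q0 : (0 < ratr q :> R)%R by exact: le_lt_trans q1.
pose k := Num.truncn (norm1 x).
have xk : cube k x.
  move=> i; rewrite mxE subr0; apply: le_lt_trans (ler_coor_norm1 x i) _.
  exact: truncnS_gt.
have AE : A (choice.pickle (q, k)) = [set v | (ratr q < f v)%R] `&` cube k.
  by rewrite /A choice.pickleK.
have Ax : A (choice.pickle (q, k)) x by rewrite AE.
have qf v : A (choice.pickle (q, k)) v -> (ratr q <= f v)%R.
  rewrite AE => -[qfv _]; exact: (ltW qfv).
(* The escaping mass [d] is allowed so that [q * (1 - d)] is exactly [f x - e]. *)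
have d0 : (0 < (ratr q - (f x - e)) / ratr q :> R)%R.
  by apply: divr_gt0; [rewrite subr_gt0; exact: q1|exact: q0].
have := hx _ Ax _ d0; apply: filterS => l.
move: (mA (choice.pickle (q, k))) qf; move: (A _) => B mB qf hl.
clear AE Ax hx leakA mA hphi A.
set s := ((phi l).+1%:R^-1 : R)%R in hl *; have s0 : (0 < s)%R by exact: sn_gt0.
apply: le_trans (ge0_integral_markov (sgauss s x) mf f0 mB (ltW q0) qf).
rewrite sgaussC//.
have : sgauss s x (~` B) \is a fin_num.
  by rewrite ge0_fin_numE// (le_lt_trans hl)// ltry.
move: hl => /[swap] /fineK <-; rewrite lee_fin => hl.
rewrite -EFinB -EFinM lee_fin.
rewrite ler_pdivlMr// in hl.
by rewrite mulrBr mulr1 mulrC; lra.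
Qed.

End lower_approximation.

(** * Transport maps from atomless laws *)

Section ternary_coding.
Context {R : realType}.
Implicit Types (b : nat -> bool) (t : R).

(** Partial sums of the points of the Cantor set: base 3 with digits 0 and 2. Unlike binary
    expansions these are unique, so the bits can be read back. *)
Fixpoint ternary_partial n b : R :=
  if n is n'.+1 then (2 * (b 0%N)%:R + ternary_partial n' (b \o succn)) / 3
  else 0.

Lemma ternary_partial_bound n b : 0 <= ternary_partial n b <= 1.
Proof.
elim: n b => [|n IH] b /=; first by rewrite lexx ler01.
have /andP[h0 h1] := IH (b \o succn).
have b01 : 0 <= ((b 0%N)%:R : R) <= 1 by case: (b 0%N); rewrite lexx ler01.
case/andP: b01 => b0 b1; apply/andP; split; last by lra.
by rewrite divr_ge0// addr_ge0// mulr_ge0.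
Qed.

Lemma ternary_partial_nd b : nondecreasing_seq (ternary_partial ^~ b).
Proof.
apply/nondecreasing_seqP => n; elim: n b => [|n IH] b.
  by rewrite [leLHS]/=; case/andP: (ternary_partial_bound 1 b).
by rewrite /= ler_pM2r// lerD2l; exact: IH.
Qed.

Definition ternary b : R := limn (ternary_partial ^~ b).

Lemma cvg_ternary b : ternary_partial ^~ b @ \oo --> ternary b.
Proof.
apply: nondecreasing_is_cvgn; first exact: ternary_partial_nd.
by exists 1 => _ [n _ <-]; case/andP: (ternary_partial_bound n b).
Qed.

Lemma ternary_bound b : 0 <= ternary b <= 1.
Proof.
apply/andP; split.
- apply: limr_ge; first by apply/cvg_ex; exists (ternary b); exact: cvg_ternary.
  by apply: nearW => n; case/andP: (ternary_partial_bound n b).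
- apply: limr_le; first by apply/cvg_ex; exists (ternary b); exact: cvg_ternary.
  by apply: nearW => n; case/andP: (ternary_partial_bound n b).
Qed.

Lemma ternary_rec b : ternary b = (2 * (b 0%N)%:R + ternary (b \o succn)) / 3.
Proof.
have h : ternary_partial n.+1 b @[n --> \oo] --> ternary b.
  by rewrite (cvg_shiftS (ternary_partial ^~ b)); exact: cvg_ternary.
apply: (cvg_unique _ h) => //=.
apply: cvgMl; apply: cvgD; first exact: cvg_cst.
exact: cvg_ternary.
Qed.

Definition ternary_shift t : R := 3 * t - 2 * (2^-1 <= t)%R%:R.

Definition ternary_digit n t := 2^-1 <= iter n ternary_shift t.

(** A leading bit 0 puts the value at most at 1/3 and a leading bit 1 at least at 2/3, so the
    threshold 1/2 separates the two cases. *)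
Lemma ternary_leading b : (2^-1 <= ternary b) = b 0%N.
Proof.
rewrite ternary_rec; have /andP[h0 h1] := ternary_bound (b \o succn).
by case: (b 0%N) => /=; [apply/idP|apply/negbTE; rewrite -ltNge]; lra.
Qed.

Lemma ternary_shiftE b : ternary_shift (ternary b) = ternary (b \o succn).
Proof.
by rewrite /ternary_shift ternary_leading ternary_rec mulrC divfK// addrAC subrr add0r.
Qed.

Lemma ternary_digitE n b : ternary_digit n (ternary b) = b n.
Proof.
rewrite /ternary_digit; elim: n b => [|n IH] b; first exact: ternary_leading.
by rewrite iterSr ternary_shiftE IH.
Qed.

Lemma measurable_ternary_digit n :
  measurable_fun [set: R] (ternary_digit n : R -> bool).
Proof.
have ms : measurable_fun [set: R] ternary_shift.
  apply: measurable_funB; first exact: measurable_funM.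
  apply: measurable_funM => //.
  rewrite (_ : (fun t : R => (2^-1 <= t)%R%:R) = \1_`[2^-1, +oo[).
    by apply: measurable_indic; exact: measurable_itv.
  by apply/funext => t; rewrite indicE mem_setE in_itv/= andbT.
have mi : measurable_fun [set: R] (iter n ternary_shift).
  elim: n => [|n IH]; first exact: measurable_id.
  by apply: measurableT_comp ms IH.
by apply: measurable_fun_ler => //; exact: mi.
Qed.

Lemma measurable_ternary d (T : measurableType d) (f : T -> nat -> bool) :
  (forall n, measurable_fun setT (fun x => f x n)) ->
  measurable_fun setT (fun x => ternary (f x)).
Proof.
move=> mf; apply: (measurable_fun_cvg (h := fun n x => ternary_partial n (f x))).
  move=> n; elim: n f mf => [|n IH] f mf /=; first exact: measurable_cst.
  apply: measurable_funM => //; apply: measurable_funD.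
    apply: measurable_funM => //.
    apply: (eq_measurable_fun (\1_[set x | f x 0%N] : T -> R)).
      by move=> x _; rewrite indicE; congr (nat_of_bool _)%:R; rewrite mem_setE.
    apply: measurable_indic.
    by have := mf 0%N measurableT [set true] I; rewrite setTI.
  by apply: (IH (fun x => f x \o succn)) => k; exact: mf.
by move=> x _; exact: cvg_ternary.
Qed.

End ternary_coding.

Section vector_coding.
Context {R : realType} {m : nat}.
Implicit Types v : 'rV[R]_m.

(** The Dedekind cuts of all the coordinates, as one sequence of bits over an enumeration of the
    pairs of a coordinate and a rational. *)
Definition rV_bits v (n : nat) : bool :=
  if @choice.unpickle ('I_m * rat)%type n is Some (i, q) then ratr q < v 0 i
  else false.

(** Unset bits, and bits of other coordinates, contribute [-oo] and leave the supremum unchanged. As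
    a countable supremum, [esups] makes measurability immediate. *)
Definition rV_decode (t : R) : 'rV[R]_m := \row_i fine (esups (fun n =>
  if @choice.unpickle ('I_m * rat)%type n is Some (j, q)
  then (if (j == i) && ternary_digit n t then (ratr q)%:E else -oo)%E
  else -oo%E) 0%N).

Definition rV_encode v : R := ternary (rV_bits v).

(* A coordinate is the supremum of the rationals below it. *)
Lemma rV_encodeK : cancel rV_encode rV_decode.
Proof.
move=> v; apply/rowP => i; rewrite mxE /esups/= /sdrop/=.
set A := [set _ | _ in _].
suff -> : ereal_sup A = (v 0 i)%:E by [].
apply/eqP; rewrite eq_le; apply/andP; split.
  apply: ge_ereal_sup => _ [n _ <-].
  rewrite /rV_encode ternary_digitE /rV_bits.
  case: choice.unpickle => [[j q]|]; last exact: leNye.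
  case: ifPn => [/andP[/eqP-> qv]|_]; last exact: leNye.
  by rewrite lee_fin ltW.
apply/lee_addgt0Pr => e e0; rewrite addeC.
have /rat_in_itvoo[q] : v 0 i - e < v 0 i by rewrite ltrBlDr ltrDl.
rewrite in_itv/= => /andP[q1 q2].
apply: (@le_trans _ _ (e%:E + (ratr q)%:E)%E).
  by rewrite -EFinD lee_fin -lerBlDl ltW.
apply: leeD2l; apply: ereal_sup_ubound; exists (choice.pickle (i, q)) => //=.
by rewrite /rV_encode ternary_digitE /rV_bits choice.pickleK eqxx q2.
Qed.

Lemma measurable_rV_encode : measurable_fun setT rV_encode.
Proof.
apply: measurable_ternary => n; rewrite /rV_bits.
case: choice.unpickle => [[i q]|]; last exact: measurable_cst.
by apply: measurable_fun_ltr => //; exact: measurable_coor.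
Qed.

Lemma measurable_rV_decode : measurable_fun setT rV_decode.
Proof.
apply: measurable_fun_rV => i; rewrite /rV_decode.
under eq_fun do rewrite mxE.
apply: measurableT_comp => //.
apply: (measurable_fun_esups (f := fun n (t : R) =>
  if @choice.unpickle ('I_m * rat)%type n is Some (j, q)
  then (if (j == i) && ternary_digit n t then (ratr q)%:E else -oo)%E
  else -oo%E)) => n.
case: choice.unpickle => [[j q]|]; last exact: measurable_cst.
apply: measurable_fun_ifT => //.
by apply: measurable_and => //; exact: measurable_ternary_digit.
Qed.

Lemma rV_encode_bound v : 0 <= rV_encode v <= 1.
Proof. exact: ternary_bound. Qed.

End vector_coding.

(** * Quantile maps from an atomless law on the line, and their lift to vectors *)

Lemma finite_measureC d (T : measurableType d) (R : realType)
    (mu : {measure set T -> \bar R}) A : (mu setT < +oo)%E -> measurable A ->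
  mu (~` A) = (mu setT - mu A)%E.
Proof. by move=> mufin mA; rewrite -setTD measureD// setTI. Qed.

Section downset.
Context d (T : measurableType d) (R : realType).
Variable mu : {measure set T -> \bar R}.

Lemma nondecreasing_measure_le (F : (set T)^nat) (y : \bar R) :
  (forall n, measurable (F n)) -> nondecreasing_seq F ->
  (forall n, mu (F n) <= y)%E -> (mu (\bigcup_n F n) <= y)%E.
Proof.
move=> mF ndF Fy.
have cF := @nondecreasing_cvg_mu _ _ _ mu F mF (bigcupT_measurable _ mF) ndF.
rewrite -(cvg_lim _ cF)//; apply: lime_le; last exact: nearW.
by apply/cvg_ex; eexists; exact: cF.
Qed.

Variable X : T -> R.
Hypothesis mX : measurable_fun setT X.

Let mXI B : measurable B -> measurable (X @^-1` B).
Proof. by move=> mB; rewrite -[X in measurable X]setTI; exact: mX. Qed.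

(** A nonempty down-set of the line is an increasing countable union of closed left rays with
    endpoints in it, whether it has a maximum, is bounded without one, or is unbounded. Continuity
    from below carries the bound over. *)
Lemma measure_downset_le (D : set R) (y : \bar R) : (0 <= y)%E ->
  (forall x z, D x -> z <= x -> D z) ->
  (forall x, D x -> (mu (X @^-1` `]-oo, x]) <= y)%E) ->
  (mu (X @^-1` D) <= y)%E.
Proof.
move=> y0 dD Dy.
have [[x0 Dx0]|/set0P/negP/negPn/eqP->] := pselect (D !=set0); last first.
  by rewrite preimage_set0 measure0.
have bigcup_le (u : nat -> R) : nondecreasing_seq u -> (forall n, D (u n)) ->
    (forall x, D x -> exists n, x <= u n) -> (mu (X @^-1` D) <= y)%E.
  move=> ndu Du Dxu.
  have -> : D = \bigcup_n `]-oo, u n]%classic.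
    apply/seteqP; split => x; first by move=> /Dxu[n xn]; exists n.
    by move=> [n _] /=; rewrite in_itv/=; exact: dD.
  rewrite preimage_bigcup; apply: nondecreasing_measure_le => //.
  - by move=> n; apply: mXI; exact: measurable_itv.
  - move=> a b ab; apply/subsetPset => w /=; rewrite !in_itv/= => /le_trans; apply.
    exact: ndu.
  - by move=> n; exact: Dy.
have [hub|nub] := pselect (has_ubound D).
  have hs : has_sup D by split => //; exists x0.
  have [Dc|nDc] := pselect (D (sup D)).
    apply: (bigcup_le (cst (sup D))) => // x Dx; exists 0%N.
    by apply: ub_le_sup.
  apply: (bigcup_le (fun n => sup D - n.+1%:R^-1)).
  - by apply/nondecreasing_seqP => n; rewrite lerB// lef_pV2 ?posrE// ler_nat.
  - move=> n; have n0 : 0 < n.+1%:R^-1 :> R by rewrite invr_gt0.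
    have [e De he] := sup_adherent n0 hs.
    by apply: dD De _; exact: ltW.
  - move=> x Dx; have : x < sup D.
      rewrite lt_neqAle ub_le_sup// andbT; apply/eqP => xD; apply: nDc.
      by rewrite -xD.
    rewrite -subr_gt0 => h; exists (Num.truncn (sup D - x)^-1).
    rewrite lerBrDr -lerBrDl ltW// invf_plt ?posrE//.
    exact: truncnS_gt.
apply: (bigcup_le (fun n => n%:R)).
- by move=> a b ab; rewrite ler_nat.
- move=> n; apply: contrapT => nDn; apply: nub; exists n%:R => x Dx.
  by rewrite leNgt; apply/negP => nx; apply: nDn; apply: dD Dx _; exact: ltW.
- by move=> x Dx; exists (Num.truncn x).+1; rewrite ltW// truncnS_gt.
Qed.

End downset.

Section quantile_transport.
Context d (T : measurableType d) (R : realType).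
Variable mu : {measure set T -> \bar R}.
Variable X : T -> R.
Hypothesis mX : measurable_fun setT X.
Hypothesis mu_fin : (mu setT < +oo)%E.
Hypothesis X_atomless : forall c, mu (X @^-1` [set c]) = 0%E.

Let mXI B : measurable B -> measurable (X @^-1` B).
Proof. by move=> mB; rewrite -[X in measurable X]setTI; exact: mX. Qed.

Let mu_fin_num A : measurable A -> mu A \is a fin_num.
Proof.
move=> mA; rewrite ge0_fin_numE// (le_lt_trans _ mu_fin)//.
exact: measure_mono.
Qed.

Let M := fine (mu setT).
Let F x := fine (mu (X @^-1` `]-oo, x])).

Let FE x : mu (X @^-1` `]-oo, x]) = (F x)%:E.
Proof. by rewrite /F fineK// mu_fin_num//; apply: mXI; exact: measurable_itv. Qed.

Let ME : mu setT = M%:E.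
Proof. by rewrite /M fineK// mu_fin_num. Qed.

Let F_nd x y : x <= y -> F x <= F y.
Proof.
move=> xy; rewrite -lee_fin -!FE; apply: measure_mono; try exact: mXI.
by move=> w /=; rewrite !in_itv/= => /le_trans; apply.
Qed.

Let FM x : F x <= M.
Proof. by rewrite -lee_fin -FE -ME; apply: measure_mono => //; exact: mXI. Qed.

Let mF (y : R) : measurable [set w | F (X w) <= y].
Proof.
apply: (mXI (B := [set x | F x <= y])); apply: is_interval_measurable.
by move=> a b /= _ Fb z /andP[_ zb]; apply: le_trans Fb; exact: F_nd.
Qed.

(** The absence of atoms enters here: the closed ray has the same mass as the open one. *)
Let upper x : mu (X @^-1` `[x, +oo[) = (M - F x)%:E.
Proof.
have -> : X @^-1` `[x, +oo[ = (~` (X @^-1` `]-oo, x])) `|` X @^-1` [set x].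
  apply/seteqP; split=> w /=; rewrite !in_itv/= ?andbT.
    by rewrite le_eqVlt => /predU1P[->|xw]; [right|left; apply/negP; rewrite -ltNge].
  by move=> [/negP|->//]; rewrite -ltNge => /ltW.
have mI : measurable (X @^-1` `]-oo, x]) by apply: mXI; exact: measurable_itv.
have -> : mu (~` (X @^-1` `]-oo, x]) `|` X @^-1` [set x]) = mu (~` (X @^-1` `]-oo, x])).
  apply/eqP; rewrite eq_le; apply/andP; split.
    apply: le_trans (measureU2 _ _ _) _; [exact: measurableC|exact: mXI|].
    by rewrite [X in (_ + X)%E]X_atomless adde0.
  apply: measure_mono; [exact: measurableC| |exact: subsetUl].
  by apply: measurableU; [exact: measurableC|exact: mXI].
by rewrite finite_measureC// FE ME.
Qed.

(** The probability integral transform: [F (X w)] is uniformly distributed on [[0, M]]. Both bounds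
    come from [measure_downset_le], the lower one through the complement. *)
Let mu_F_le y : 0 <= y -> y <= M -> mu [set w | F (X w) <= y] = y%:E.
Proof.
move=> y0 yM; apply/eqP; rewrite eq_le; apply/andP; split.
  apply: (measure_downset_le mX (D := [set x | F x <= y])).
  - by rewrite lee_fin.
  - by move=> x z /= Fx zx; apply: le_trans Fx; exact: F_nd.
  - by move=> x /= Fx; rewrite FE lee_fin.
(* Changing the sign of [X] turns the up-set where [F] exceeds [y] into a down-set. *)
pose NX w := - X w.
have mNX : measurable_fun setT NX by exact: measurableT_comp.
have : (mu (NX @^-1` [set x | (y < F (- x))%R]) <= (M - y)%:E)%E.
  apply: (measure_downset_le mNX).
  - by rewrite lee_fin subr_ge0.
  - by move=> x z /= Fx zx; apply: lt_le_trans Fx _; apply: F_nd; rewrite lerN2.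
  - move=> x /= Fx.
    have -> : NX @^-1` `]-oo, x] = X @^-1` `[- x, +oo[.
      by apply/seteqP; split=> w /=; rewrite !in_itv/= andbT /NX lerNl.
    by rewrite upper lee_fin lerD2l lerN2 ltW.
have -> : NX @^-1` [set x | y < F (- x)] = ~` [set w | F (X w) <= y].
  by apply/seteqP; split=> w /=; rewrite /NX opprK ltNge => /negP.
rewrite (finite_measureC mu_fin (mF y)).
rewrite ME -[mu [set _ | _]]fineK ?mu_fin_num//.
by rewrite -EFinB !lee_fin lerD2l lerN2.
Qed.

Variable kappa : {measure set R -> \bar R}.
Hypothesis kappa_mass : kappa setT = mu setT.
Hypothesis kappa01 : kappa (~` `[0, 1]) = 0%E.

Let kappa_fin_num A : measurable A -> kappa A \is a fin_num.
Proof.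
move=> mA; rewrite ge0_fin_numE//.
apply: (@le_lt_trans _ _ (kappa setT)); last by rewrite kappa_mass.
exact: measure_mono.
Qed.

Let H t := fine (kappa `]-oo, t]%classic).

Let HE t : kappa `]-oo, t]%classic = (H t)%:E.
Proof. by rewrite /H fineK// kappa_fin_num. Qed.

Let H_nd x y : x <= y -> H x <= H y.
Proof.
move=> xy; rewrite -lee_fin -!HE; apply: measure_mono => //.
by move=> w /=; rewrite !in_itv/= => /le_trans; apply.
Qed.

Let H_ge0 t : 0 <= H t. Proof. by rewrite fine_ge0. Qed.

Let H_leM t : H t <= M.
Proof. by rewrite -lee_fin -HE -ME -kappa_mass; exact: measure_mono. Qed.

Let H_lt0 t : t < 0 -> H t = 0.
Proof.
move=> t0; rewrite /H (_ : kappa _ = 0%E)//.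
apply/eqP; rewrite eq_le measure_ge0 andbT -kappa01; apply: measure_mono => //.
  by apply: measurableC; exact: measurable_itv.
move=> x /=; rewrite !in_itv/= => xt /andP[x0 _].
by move: t0; rewrite ltNge (le_trans x0 xt).
Qed.

Let H_ge1 t : 1 <= t -> H t = M.
Proof.
move=> t1; apply/eqP; rewrite eq_le H_leM/= -lee_fin -HE -ME -kappa_mass.
rewrite -(setUv `]-oo, t]%classic).
apply: le_trans (measureU2 _ _ _) _ => //; first exact: measurableC.
rewrite -[leRHS]adde0 leeD2l// -kappa01.
apply: measure_mono; [exact: measurableC|apply: measurableC; exact: measurable_itv|].
apply: subsetC => x /=; rewrite !in_itv/= => /andP[_ x1].
exact: le_trans x1 t1.
Qed.

(** Right continuity of the distribution function, by continuity of [kappa] from above. *)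
Let H_right t y : (forall n, y <= H (t + n.+1%:R^-1)) -> y <= H t.
Proof.
move=> Hy.
have cH : (kappa `]-oo, (t + n.+1%:R^-1)%R]%classic @[n --> \oo] --> kappa `]-oo, t]%classic)%E.
  have -> : `]-oo, t]%classic = \bigcap_n `]-oo, t + n.+1%:R^-1]%classic.
    apply/seteqP; split=> x /=; rewrite in_itv/=.
      by move=> xt n _ /=; rewrite in_itv/=; apply: le_trans xt _; rewrite lerDl.
    move=> h; apply/ler_addgt0Pr => e e0.
    have := h (Num.truncn e^-1) I; rewrite /= in_itv/= => /le_trans; apply.
    by rewrite lerD2l ltW// invf_plt ?posrE// truncnS_gt.
  apply: (nonincreasing_cvg_mu (mu := kappa)
    (F := fun n => `]-oo, (t + n.+1%:R^-1)%R]%classic)).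
  - by rewrite -ge0_fin_numE// kappa_fin_num.
  - by move=> n; exact: measurable_itv.
  - by apply: bigcapT_measurable => n; exact: measurable_itv.
  - move=> a b ab; apply/subsetPset => x /=; rewrite !in_itv/= => /le_trans; apply.
    by rewrite lerD2l lef_pV2 ?posrE// ler_nat.
rewrite -lee_fin -HE -(cvg_lim _ cH)//; apply: lime_ge.
  by apply/cvg_ex; eexists; exact: cH.
by apply: nearW => n; rewrite HE lee_fin.
Qed.

(** [S] is the generalized inverse of [H] evaluated at [F (X w)]. Restricting [t] to [[0, 1]], which
    carries [kappa], makes the infimum that of a nonempty bounded set. *)
Let A w := [set t | 0 <= t <= 1 /\ F (X w) <= H t].
Let S w := inf (A w).

Let A1 w : A w 1.
Proof. by split; [rewrite ler01 lexx|rewrite H_ge1]. Qed.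

Let A_lb w : has_lbound (A w).
Proof. by exists 0 => t [/andP[]]. Qed.

Let A_inf w : has_inf (A w). Proof. by split; [exists 1; exact: A1|exact: A_lb]. Qed.

(** The Galois relation between a distribution function and its quantile function; one direction
    needs right continuity, since the infimum is only approached from the right. *)
Let S_le w t : 0 <= t -> t <= 1 -> (S w <= t) = (F (X w) <= H t).
Proof.
move=> t0 t1; apply/idP/idP => [St|Ft]; last first.
  by apply: ge_inf => //; split=> //; rewrite t0 t1.
apply: H_right => n; have n0 : 0 < n.+1%:R^-1 :> R by rewrite invr_gt0.
have [u [_ Fu] uS] := inf_adherent n0 (A_inf w).
by apply: le_trans Fu _; apply: H_nd; rewrite (le_trans (ltW uS))// lerD2r.
Qed.

Let S01 w : 0 <= S w <= 1.
Proof.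
apply/andP; split; last by apply: ge_inf.
by apply: lb_le_inf; [exists 1; exact: A1|move=> t [/andP[]]].
Qed.

Let S_preimage t : measurable [set w | S w <= t] /\ mu [set w | S w <= t] = (H t)%:E.
Proof.
have [t0|t0] := ltP t 0.
  have -> : [set w | S w <= t] = set0.
    rewrite -subset0 => w /= Sw; have /andP[S0 _] := S01 w.
    by move: t0; rewrite ltNge (le_trans S0 Sw).
  by rewrite measure0 H_lt0.
have [t1|t1] := leP t 1.
  have -> : [set w | S w <= t] = [set w | F (X w) <= H t].
    by apply/seteqP; split=> w /=; rewrite S_le.
  by split; [exact: mF|rewrite mu_F_le].
have -> : [set w | S w <= t] = setT.
  rewrite -subTset => w _ /=; have /andP[_ S1] := S01 w.
  exact: le_trans S1 (ltW t1).
by rewrite ME H_ge1// ltW.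
Qed.

(** The image of [mu] under [S] and [kappa] agree on open right rays, which are stable under
    intersection and generate the Borel sets. *)
Lemma quantile_transport : exists2 S : T -> R, measurable_fun setT S &
  forall B, measurable B -> mu (S @^-1` B) = kappa B.
Proof.
have SoE t : S @^-1` `]t, +oo[ = ~` [set w | S w <= t].
  apply/seteqP; split=> w /=; rewrite in_itv/= andbT ltNge; first by move/negP.
  by move/negP.
have mS : measurable_fun setT S.
  apply: (measurability _ (RGenOInfty.measurableE R)) => //.
  move=> _ [_ [t ->] <-]; rewrite setTI SoE; apply: measurableC.
  exact: (S_preimage t).1.
exists S => // B mB.
have mG : @measurable _ R = <<s (@RGenOInfty.G R) >> by exact: RGenOInfty.measurableE.
apply: (measure_unique (@RGenOInfty.G R) (fun n => `](- n%:R)%R, +oo[%classic)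
   mG _ _ _ (pushforward mu S) kappa) => //.
- move=> _ _ [a ->] [b ->]; exists (Num.max a b).
  by apply/seteqP; split=> x /=; rewrite !in_itv/= !andbT gt_max; [move=> [-> ->]|move/andP].
- by move=> n; exists (- n%:R).
- rewrite -subTset => x _; exists (Num.truncn (- x)).+1 => //=.
  by rewrite in_itv/= andbT ltrNl truncnS_gt.
- move=> _ [t ->]; transitivity (mu (S @^-1` `]t, +oo[)) => //; rewrite SoE.
  have [mSt muSt] := S_preimage t.
  rewrite finite_measureC// muSt -setCitvl finite_measureC//.
    by rewrite HE kappa_mass.
  by rewrite kappa_mass.
- move=> n; have mSn : measurable (S @^-1` `](- n%:R)%R, +oo[).
    by rewrite -[_ @^-1` _]setTI; apply: mS => //; exact: measurable_itv.
  have : (mu (S @^-1` `](- n%:R)%R, +oo[) < +oo)%E; last by [].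
  apply: le_lt_trans mu_fin.
  exact: (measure_mono mu mSn measurableT (@subsetT _ _)).
Qed.

End quantile_transport.

Lemma pushforward_measure d1 d2 (T1 : measurableType d1) (T2 : measurableType d2)
    (R : realType) (mu : {measure set T1 -> \bar R}) (f : T1 -> T2) :
  measurable_fun setT f ->
  exists nu : {measure set T2 -> \bar R}, forall B, nu B = mu (f @^-1` B).
Proof.
move=> mf.
unshelve refine (ex_intro _ (pushforward mu f : {measure set T2 -> \bar R}) _) => //.
Qed.

Section transport.
Context d (T : measurableType d) (R : realType) (m : nat).
Variables (mu : {measure set T -> \bar R}) (nu : {measure set 'rV[R]_m -> \bar R}).

(** Reduction to the line: [nu] is coded on [[0, 1]], reached from [mu] by a quantile map, and
    decoded. Decoding inverts the coding at every vector, so it recovers [nu]. *)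
Lemma exists_transport_map (X : T -> R) : measurable_fun setT X ->
  (mu setT < +oo)%E -> (forall c, mu (X @^-1` [set c]) = 0%E) ->
  nu setT = mu setT ->
  exists2 S : T -> 'rV[R]_m, measurable_fun setT S &
    forall B, measurable B -> mu (S @^-1` B) = nu B.
Proof.
move=> mX mufin Xat numu.
have mE := @measurable_rV_encode R m; have mD := @measurable_rV_decode R m.
have [kappa kappaE] := pushforward_measure nu mE.
have [||S mS SE] := quantile_transport mX mufin Xat (kappa := kappa).
- by rewrite kappaE preimage_setT.
- rewrite kappaE (_ : _ @^-1` _ = set0) ?measure0// -subset0 => v /=; apply.
  by rewrite /= in_itv/=; exact: rV_encode_bound.
exists (rV_decode \o S); first exact: measurableT_comp mD mS.
move=> B mB; rewrite comp_preimage SE.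
  rewrite kappaE -comp_preimage; congr (nu _).
  by apply/seteqP; split=> v /=; rewrite rV_encodeK.
by rewrite -[_ @^-1` _]setTI; exact: mD.
Qed.

End transport.

(** * Weighted images and mixtures of measures *)

Section image_measure.
Local Open Scope ereal_scope.

(** With a normalizing weight this yields conditional laws given an event, and with weight 1 on the
    whole space plain images. *)
Lemma weighted_image d1 d2 (T1 : measurableType d1) (T2 : measurableType d2)
    (R : realType) (mu : {measure set T1 -> \bar R}) (f : T1 -> T2) (D : set T1)
    (c : {nonneg R}) : measurable D -> measurable_fun setT f ->
  exists nu : {measure set T2 -> \bar R},
    (forall B, measurable B -> nu B = c%:num%:E * mu (f @^-1` B `&` D)) /\
    (forall g : T2 -> \bar R, measurable_fun setT g -> (forall y, 0 <= g y) ->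
      \int[nu]_y g y = c%:num%:E * \int[mu]_(x in D) g (f x)).
Proof.
move=> mD mf; pose muD : {measure set T1 -> \bar R} := mrestr mu mD.
unshelve refine (ex_intro _
  (pushforward (mscale c muD) f : {measure set T2 -> \bar R}) _); first exact: mf.
split => // g mg g0.
rewrite ge0_integral_pushforward//.
rewrite preimage_setT (ge0_integral_mscale muD measurableT c (f := g \o f)
  (measurableT_comp mg mf) (fun x _ => g0 (f x))).
congr (_ * _).
rewrite (ge0_integral_density (mu := mu) (g := \1_D))//.
- rewrite [RHS]integral_mkcond; apply: eq_integral => x _.
  by rewrite patchE indicE; case: (x \in D); rewrite ?mule1 ?mule0.
- by move=> A mA; rewrite integral_indic// setIC.
- exact: measurableT_comp.
- by move=> x; exact: g0.
Qed.

Lemma ge0_integral_mixture d (T : measurableType d) (R : realType) (N : nat)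
    (nu : 'I_N -> {measure set T -> \bar R}) (f : T -> \bar R) :
  measurable_fun setT f -> (forall x, 0 <= f x) ->
  \int[mixture nu]_x f x = (N%:R^-1)%:E * \sum_(k < N) \int[nu k]_x f x.
Proof.
move=> mf f0.
(* [msum] takes families indexed by the naturals, so the family is completed by the zero measure. *)
pose nu' (k : nat) : {measure set T -> \bar R} := oapp nu mzero (insub k).
rewrite (eq_measure_integral (mscale ((N%:R^-1 : R)%:nng)%R (msum nu' N))).
  rewrite ge0_integral_mscale// ge0_integral_measure_sum//.
  by congr (_ * _); apply: eq_bigr => k _; rewrite /nu' valK.
move=> A mA _; rewrite /mscale/= /msum/mixture; congr (_ * _).
by apply: eq_bigr => k _; rewrite /nu' valK.
Qed.

End image_measure.

(** * Couplings with an empirical law *)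

Section disintegration.
Local Open Scope ereal_scope.
Context {R : realType} {m N : nat}.
Variables (x : 'I_N -> 'rV[R]_m) (N_gt0 : (0 < N)%N).

Lemma measurable_set1_rV (c : 'rV[R]_m) : measurable [set c].
Proof. by apply: compact_measurable_rV; exact: compact_set1. Qed.

(* The sample points may coincide: an atom is shared equally among its indices. *)
Let mult k := #|[pred j | x j == x k]|.

Let mult_gt0 k : (0 < mult k)%N.
Proof. by apply/card_gt0P; exists k; rewrite inE. Qed.

(** Disintegration is elementary when the second marginal has finite support: [Q k] is the law of
    the first coordinate conditioned on the second being [x k]. *)
Lemma coupling_empirical (pi : probability ('rV[R]_m * 'rV[R]_m)%type R) :
  (forall A, measurable A -> pi (setT `*` A) = empirical x A) ->
  exists Q : 'I_N -> {measure set 'rV[R]_m -> \bar R},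
    (forall k, Q k setT = 1) /\
    forall f : 'rV[R]_m * 'rV[R]_m -> \bar R, measurable_fun setT f ->
      (forall z, 0 <= f z) ->
      \int[pi]_z f z = (N%:R^-1)%:E * \sum_(k < N) \int[Q k]_y f (y, x k).
Proof.
move=> piE.
have N0 : (N%:R != 0 :> R)%R by rewrite pnatr_eq0 -lt0n.
pose D k : set ('rV[R]_m * 'rV[R]_m) := setT `*` [set x k].
have mD k : measurable (D k) by apply: measurableX => //; exact: measurable_set1_rV.
have w0 k : (0 <= N%:R / (mult k)%:R :> R)%R by rewrite divr_ge0.
(* The event [D k] has mass [(mult k)%:R / N%:R] under [pi], which explains the normalizing
   factor. *)
have /choice[Q hQ] : forall k, exists nu : {measure set 'rV[R]_m -> \bar R},
    (forall B, measurable B ->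
      nu B = (N%:R / (mult k)%:R)%:E * pi (fst @^-1` B `&` D k)) /\
    (forall g : 'rV[R]_m -> \bar R, measurable_fun setT g -> (forall y, 0 <= g y) ->
      \int[nu]_y g y = (N%:R / (mult k)%:R)%:E * \int[pi]_(z in D k) g z.1).
  by move=> k; exact: (weighted_image pi (NngNum (w0 k)) (mD k) measurable_fst).
have card_mult k : \sum_(j < N) (\1_[set x k] (x j) : R)%:E = (mult k)%:R%:E.
  rewrite sumEFin /mult -sum1_card natr_sum [in RHS]big_mkcond/=; congr EFin.
  apply: eq_bigr => j _; rewrite indicE inE.
  have -> : (x j \in [set x k]%classic) = (x j == x k).
    by apply/idP/eqP => [/set_mem//|->]; exact/mem_set.
  by case: eqP.
exists Q; split => [k|f mf f0].
  rewrite (hQ k).1// preimage_setT setTI piE; last exact: measurable_set1_rV.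
  rewrite /empirical/= /mixture/= /dirac card_mult.
  rewrite -!EFinM; congr EFin; field.
  by rewrite N0 pnatr_eq0 -lt0n mult_gt0.
have mfx k : measurable_fun setT (fun y => f (y, x k)).
  by apply: measurableT_comp mf _; apply: measurable_fun_pair.
pose w k : \bar R := ((mult k)%:R^-1)%:E.
(* Each index sharing an atom receives the fraction [w k] of it, so that together they count it
   once. *)
transitivity (\int[pi]_z \sum_(k < N) (w k * ((\1_(D k) z)%:E * f z))); last first.
  rewrite ge0_integral_sum//; first last.
  - by move=> k z _; rewrite !mule_ge0// lee_fin.
  - move=> k; apply: measurable_funeM; apply: emeasurable_funM => //.
    by apply/measurable_EFinP; exact: measurable_indic.
  rewrite ge0_sume_distrr; last first.
    by move=> k _; apply: integral_ge0 => y _; exact: f0.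
  apply: eq_bigr => k _; rewrite (hQ k).2//.
  rewrite ge0_integralZl_EFin//; first last.
  - by apply: emeasurable_funM => //; apply/measurable_EFinP; exact: measurable_indic.
  - by move=> z _; rewrite mule_ge0// lee_fin.
  rewrite muleA -EFinM mulrA mulVf// mul1r; congr (_ * _).
  rewrite [RHS]integral_mkcond; apply: eq_integral => -[y1 y2] _.
  rewrite patchE indicE; case: (boolP (_ \in D k)) => [/set_mem[_ /= ->]|_].
    by rewrite mul1e.
  by rewrite mul0e.
pose E : set ('rV[R]_m * 'rV[R]_m) := setT `*` \bigcup_(k in [set: 'I_N]) [set x k].
have mU : measurable (\bigcup_(k in [set: 'I_N]) [set x k]).
  by apply: fin_bigcup_measurable => // k _; exact: measurable_set1_rV.
apply: ge0_ae_eq_integral => //.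
- apply: emeasurable_sum => k; apply: measurable_funeM; apply: emeasurable_funM => //.
  by apply/measurable_EFinP; exact: measurable_indic.
- by move=> z _; apply: sume_ge0 => k _; rewrite !mule_ge0// lee_fin.
(* The pairs whose second coordinate is no sample point form a null set, by the second marginal. *)
exists (setT `*` ~` (\bigcup_(k in [set: 'I_N]) [set x k])); split.
- by apply: measurableX => //; exact: measurableC.
- apply: (etrans (piE _ (measurableC mU))).
  rewrite /empirical/= /mixture/= big1 ?mule0// => k _.
  by rewrite diracE memNset// => /=; apply; exists k.
move=> [y1 y2] /= h; split => // -[j _ /= y2E]; apply: h => _.
rewrite y2E.
have -> : \sum_(k < N) w k * ((\1_(D k) (y1, x j))%:E * f (y1, x j)) =
   \sum_(k < N) (w j * f (y1, x j)) * (\1_[set x j] (x k) : R)%:E.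
  apply: eq_bigr => k _; rewrite !indicE.
  have -> : ((y1, x j) \in D k) = (x k \in [set x j]%classic).
    apply/idP/idP => [/set_mem[_ /= ->]|/set_mem /= xkj]; first exact/mem_set.
    by apply/mem_set; split => //=; rewrite xkj.
  case: (boolP (x k \in _)) => [/set_mem /= xkj|_].
    by rewrite mule1 mul1e /w /mult xkj.
  by rewrite mule0 mul0e mule0.
rewrite -ge0_sume_distrr; last by move=> k _; rewrite lee_fin.
rewrite card_mult muleAC /w -EFinM mulVf ?mul1e//.
by rewrite pnatr_eq0 -lt0n mult_gt0.
Qed.

End disintegration.

(** * Transport from a mixture, cell by cell *)

Section mixture_transport.
Local Open Scope ereal_scope.
Context {R : realType} {m : nat}.
Implicit Types v y : 'rV[R]_m.

(** The cells are the grid cubes of side [e], numbered by a code of the integer vector of floors. A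
    chosen point of each cell serves as its centre, with 0 as default for the empty ones. *)
Lemma small_cells (e : R) : (0 < e)%R ->
  exists (C : nat -> set 'rV[R]_m) (c : nat -> 'rV[R]_m),
    [/\ forall j, measurable (C j), trivIset setT C, \bigcup_j C j = setT &
        forall j v, C j v -> (norm1 (v - c j) <= m%:R * e)%R].
Proof.
move=> e0.
pose fl v : 'rV[int]_m := \row_i Num.floor (v 0%R i / e)%R.
pose C j := [set v | choice.pickle (fl v) = j].
exists C, (fun j => xget 0%R (C j)); split.
- move=> j; case: (pselect (exists z : 'rV[int]_m, choice.pickle z = j)) => [[z <-]|nz].
    have -> : C (choice.pickle z) = \bigcap_(i in [set: 'I_m])
        [set v | (v 0 i / e)%R \in `[(z 0 i)%:~R, (z 0 i + 1)%:~R[ ].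
      apply/seteqP; split => v /=.
        move=> /(pcan_inj (@choice.pickleK _)) <- i _ /=.
        by rewrite in_itv/= !mxE floor_le_tmp floorD1_gt.
      move=> h; congr choice.pickle; apply/rowP => i; rewrite mxE.
      by apply: floor_def; have := h i I; rewrite /= in_itv.
    apply: fin_bigcap_measurable => // i _.
    have mi : measurable_fun setT (fun v : 'rV[R]_m => v 0 i / e)%R.
      by apply: measurable_funM => //; exact: measurable_coor.
    have := mi measurableT `[(z 0 i)%:~R, (z 0 i + 1)%:~R[%classic (measurable_itv _).
    by rewrite setTI.
  have -> : C j = set0 by rewrite -subset0 => v /= vj; apply: nz; exists (fl v).
  exact: measurable0.
- apply/trivIsetP => i j _ _ ij; rewrite -subset0 => v /= [Ci Cj].
  by move: ij; rewrite -Ci -Cj eqxx.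
- by rewrite -subTset => v _; exists (choice.pickle (fl v)).
- move=> j v Cv; apply: norm1_le => i.
  have /(_ _ Cv) Cc : forall v, C j v -> C j (xget 0%R (C j)) by move=> w; exact: xgetI.
  have flE : fl v = fl (xget 0%R (C j)).
    by apply: (pcan_inj (@choice.pickleK _)); rewrite Cv Cc.
  have : Num.floor (v 0%R i / e)%R = Num.floor (xget 0%R (C j) 0%R i / e)%R.
    by move: flE => /rowP/(_ i); rewrite !mxE.
  rewrite !mxE; move: (xget 0%R (C j) 0%R i) => b vb.
  have va := floor_itv (v 0%R i / e)%R.
  have bb := floor_itv (b / e)%R.
  rewrite vb in va; case/andP: va => va1 va2; case/andP: bb => bb1 bb2.
  rewrite intrD in va2 bb2.
  rewrite -[leRHS]mul1r -ler_pdivrMr// -[X in (_ / X)%R](gtr0_norm e0) -normf_div mulrBl ler_norml.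
  by apply/andP; split; lra.
Qed.

(** The model is the plan sending a point drawn from [nu k] to an independent draw from [Q k]. On
    each cell a map reproduces the image law [nuQ j] of this plan, and the maps are glued. The cost
    agrees with that of the plan up to two passages through the cell centre, whence the factor 2;
    the remaining terms are the triangle inequality through [x k]. *)
Lemma mixture_transport (N : nat) (i0 : 'I_m) (x : 'I_N -> 'rV[R]_m)
    (nu Q : 'I_N -> {measure set 'rV[R]_m -> \bar R}) (e : R) :
  (0 < N)%N ->
  (forall k, nu k setT = 1) -> (forall k, Q k setT = 1) ->
  (forall k c, nu k [set v : 'rV[R]_m | v 0%R i0 = c] = 0) -> (0 < e)%R ->
  exists2 T : 'rV[R]_m -> 'rV[R]_m, measurable_fun setT T &
    (forall B, measurable B -> mixture nu (T @^-1` B) = mixture Q B) /\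
    \int[mixture nu]_v (norm1 (v - T v))%:E <=
    (N%:R^-1)%:E * \sum_(k < N) ((2 * (m%:R * e))%:E +
      \int[nu k]_v (norm1 (v - x k))%:E + \int[Q k]_y (norm1 (y - x k))%:E).
Proof.
move=> N_gt0 nu1 Q1 nu_at e0.
have [C [c [mC tC UC Cc]]] := small_cells e0.
have nuC_fin k A : measurable A -> nu k A \is a fin_num.
  move=> mA; rewrite ge0_fin_numE//; apply: (@le_lt_trans _ _ 1); last exact: ltry.
  by rewrite -(nu1 k); exact: measure_mono.
have w0 k j : (0 <= fine (nu k (C j)))%R by rewrite fine_ge0.
pose nuQ j : {measure set 'rV[R]_m -> \bar R} :=
  mixture (fun k => mscale (NngNum (w0 k j)) (Q k)).
have nuQE j B : nuQ j B = (N%:R^-1)%:E * \sum_(k < N) nu k (C j) * Q k B.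
  rewrite /nuQ/= /mixture; congr (_ * _); apply: eq_bigr => k _.
  by rewrite -[in RHS](fineK (nuC_fin k _ (mC j))).
pose mu : {measure set 'rV[R]_m -> \bar R} := mixture nu.
pose muC j : {measure set 'rV[R]_m -> \bar R} := mrestr mu (mC j).
have muCE j A : muC j A = mu (A `&` C j) by [].
have mu1 : mu setT = 1.
  rewrite /mu/= /mixture (eq_bigr (fun=> 1)) => [|k _]; last exact: nu1.
  rewrite sumEFin sumr_const card_ord -EFinM mulVf//.
  by rewrite pnatr_eq0 -lt0n.
have mhyp t : measurable [set v : 'rV[R]_m | v 0%R i0 = t].
  rewrite -[[set v | _]]setTI.
  exact: (measurable_coor i0 measurableT (measurable_set1 t)).
have /choice[S hS] : forall j, exists S : 'rV[R]_m -> 'rV[R]_m,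
    measurable_fun setT S /\
    forall B, measurable B -> mu (S @^-1` B `&` C j) = nuQ j B.
  move=> j.
  have [||||S mS SE] := @exists_transport_map _ _ R m (muC j) (nuQ j)
      (fun v : 'rV[R]_m => v 0%R i0).
  - exact: measurable_coor.
  - rewrite muCE setTI; apply: (@le_lt_trans _ _ 1); last exact: ltry.
    by rewrite -mu1; exact: measure_mono.
  - move=> t; rewrite muCE; apply/eqP; rewrite eq_le measure_ge0 andbT.
    apply: (@le_trans _ _ (mu [set v : 'rV[R]_m | v 0%R i0 = t])).
      apply: measure_mono; [|exact: mhyp|exact: subIsetl].
      by apply: measurableI; [exact: mhyp|exact: mC].
    by rewrite /mu/= /mixture big1 ?mule0// => k _; exact: nu_at.
  - rewrite nuQE muCE setTI /mu/= /mixture; congr (_ * _); apply: eq_bigr => k _.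
    by rewrite Q1 mule1.
  - by exists S; split => // B mB; rewrite -SE.
have mS j : measurable_fun setT (S j) by case: (hS j).
have SE j B : measurable B -> mu (S j @^-1` B `&` C j) = nuQ j B.
  by case: (hS j) => _; apply.
have cellP v : exists j, C j v.
  have : setT v by []. by rewrite -UC => -[j _ Cjv]; exists j.
have /choice[J hJ] := cellP.
have JE j v : C j v -> J v = j.
  move=> Cjv; apply: contrapT => /eqP Jj.
  have /trivIsetP/(_ (J v) j I I Jj) := tC.
  by rewrite -subset0 => /(_ v); apply; split=> //; exact: hJ.
pose T v := S (J v) v.
have TE B : T @^-1` B = \bigcup_j (S j @^-1` B `&` C j).
  apply/seteqP; split => v /=; first by move=> Bv; exists (J v).
  by move=> [j _ [/= Sj Cjv]]; rewrite /T (JE _ _ Cjv).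
have mSC j B : measurable B -> measurable (S j @^-1` B `&` C j).
  by move=> mB; apply: measurableI => //; rewrite -[_ @^-1` _]setTI; exact: mS.
have mT : measurable_fun setT T.
  move=> _ B mB; rewrite setTI TE; apply: bigcupT_measurable => j; exact: mSC.
have tSC B : trivIset setT (fun j => S j @^-1` B `&` C j) by exact: trivIset_setIl.
have sum_nuC k : \sum_(0 <= j <oo) nu k (C j) = 1.
  rewrite -(nu1 k) -UC measure_semi_bigcup//.
  by rewrite UC.
exists T => //; split.
  move=> B mB; rewrite TE.
  have -> : mixture nu (\bigcup_j (S j @^-1` B `&` C j)) =
      \sum_(0 <= j <oo) mu (S j @^-1` B `&` C j).
    apply: (measure_semi_bigcup mu) => //; first by move=> j; exact: mSC.
    by apply: bigcupT_measurable => j; exact: mSC.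
  under eq_eseriesr => j _ do rewrite SE// nuQE.
  rewrite nneseriesZl; last by move=> j _; apply: sume_ge0 => k _; exact: mule_ge0.
  rewrite nneseries_sum; last by move=> k j _; exact: mule_ge0.
  rewrite /mixture; congr (_ * _); apply: eq_bigr => k _.
  have QBfin : Q k B \is a fin_num.
    rewrite ge0_fin_numE//; apply: (@le_lt_trans _ _ 1); last exact: ltry.
    by rewrite -(Q1 k); exact: measure_mono.
  under eq_eseriesr => j _ do rewrite muleC -(fineK QBfin).
  by rewrite nneseriesZl// sum_nuC mule1 fineK.
(* [phi k v] bounds the mean cost of sending [v], drawn from [nu k], to a draw from [Q k] through
   [x k], with the two cell corrections. *)
pose phi k v := ((2 * (m%:R * e))%:E + (norm1 (v - x k))%:E +
  \int[Q k]_y (norm1 (y - x k))%:E).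
have mn y : measurable_fun setT (fun v => (norm1 (v - y))%:E).
  by apply/measurable_EFinP; exact: measurable_fun_norm1B.
have n0 v : 0 <= (norm1 v)%:E by rewrite lee_fin norm1_ge0.
have e20 : (0 <= 2 * (m%:R * e))%R by rewrite !mulr_ge0// ltW.
have q0 k : 0 <= \int[Q k]_y (norm1 (y - x k))%:E by exact: integral_ge0.
have mphi k : measurable_fun setT (phi k).
  by apply: emeasurable_funD => //; apply: emeasurable_funD.
have phi0 k v : 0 <= phi k v.
  by rewrite /phi; apply: adde_ge0 => //; apply: adde_ge0 => //; rewrite lee_fin.
have phi_int k : \int[nu k]_v phi k v = (2 * (m%:R * e))%:E +
      \int[nu k]_v (norm1 (v - x k))%:E + \int[Q k]_y (norm1 (y - x k))%:E.
  rewrite /phi ge0_integralD//.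
  - rewrite ge0_integralD//.
    by rewrite !integral_cst//; rewrite nu1 !mule1.
  - by move=> v _; apply: adde_ge0 => //; rewrite lee_fin.
  - exact: emeasurable_funD.
under eq_bigr => k _ do rewrite -phi_int.
have mg : measurable_fun setT (fun v => (norm1 (v - T v))%:E).
  by apply/measurable_EFinP; exact: measurable_fun_norm1B.
rewrite -UC ge0_integral_bigcup//; last by rewrite UC.
have cell_le j : \int[mu]_(v in C j) (norm1 (v - T v))%:E <=
    (N%:R^-1)%:E * \sum_(k < N) \int[nu k]_(v in C j) phi k v.
  pose me : R := (m%:R * e)%R.
  have me0 : (0 <= me)%R by rewrite mulr_ge0// ltW.
  have mnS : measurable_fun setT (fun v => (norm1 (S j v - c j))%:E).
    by apply/measurable_EFinP; exact: measurable_fun_norm1B.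
  apply: (@le_trans _ _ (\int[mu]_(v in C j) (me%:E + (norm1 (S j v - c j))%:E))).
    apply: ge0_le_integral => //.
    - by apply: measurable_funTS.
    - by apply: emeasurable_funD => //; exact: measurable_funTS.
    - move=> v Cv; rewrite -EFinD lee_fin /T (JE _ _ Cv).
      apply: (le_trans (norm1_triangle (c j) _ _)); rewrite (norm1_dist (c j)).
      by rewrite lerD2r; exact: Cc.
  rewrite ge0_integralD//; last exact: measurable_funTS.
  rewrite integral_cst//.
  have -> : \int[mu]_(v in C j) (norm1 (S j v - c j))%:E =
      (N%:R^-1)%:E * \sum_(k < N) nu k (C j) * \int[Q k]_y (norm1 (y - c j))%:E.
    have [nu' [nu'E nu'I]] := weighted_image mu (1%:nng)%R (mC j) (mS j).
    have := nu'I (fun y => (norm1 (y - c j))%:E) (mn (c j)) (fun y => n0 _).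
    rewrite mul1e => <-.
    rewrite (eq_measure_integral (nuQ j)); last first.
      by move=> A mA _; rewrite nu'E// mul1e SE.
    rewrite ge0_integral_mixture//; congr (_ * _); apply: eq_bigr => k _.
    by rewrite ge0_integral_mscale//= fineK// nuC_fin.
  have -> : me%:E * mu (C j) = (N%:R^-1)%:E * \sum_(k < N) me%:E * nu k (C j).
    rewrite -ge0_sume_distrr; last by move=> k _; exact: measure_ge0.
    by rewrite /mu/= /mixture muleCA.
  rewrite -ge0_muleDr; first last.
  - by apply: sume_ge0 => k _; apply: mule_ge0 => //; exact: integral_ge0.
  - by apply: sume_ge0 => k _; apply: mule_ge0 => //; rewrite lee_fin.
  rewrite lee_wpmul2l ?lee_fin//; rewrite -big_split/=; apply: lee_sum => k _.
  have q'0 : 0 <= \int[Q k]_y (norm1 (y - c j))%:E by exact: integral_ge0.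
  have me0E : 0 <= me%:E by rewrite lee_fin.
  (* Writing the constants as integrals over the cell allows a pointwise comparison with [phi k]. *)
  have -> : me%:E * nu k (C j) + nu k (C j) * \int[Q k]_y (norm1 (y - c j))%:E =
      \int[nu k]_(v in C j) (me%:E + \int[Q k]_y (norm1 (y - c j))%:E).
    rewrite (integral_cst (nu k) (mC j)) (muleC (nu k (C j))).
    exact/esym/ge0_muleDl.
  apply: (ge0_le_integral (nu k) (mC j)).
  - by move=> v _; exact: adde_ge0.
  - exact: measurable_cst.
  - exact: measurable_funTS.
  move=> v Cv.
  apply: (@le_trans _ _ (me%:E + \int[Q k]_y ((norm1 (y - x k))%:E + (norm1 (x k - c j))%:E))).
    rewrite leeD2l//; apply: ge0_le_integral => //.
    - by apply: emeasurable_funD.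
    - by move=> y _; rewrite -EFinD lee_fin norm1_triangle.
  rewrite ge0_integralD// integral_cst// Q1 mule1 /phi.
  rewrite (addeC (\int[Q k]_y _)) addeA leeD2r// -!EFinD lee_fin.
  have h1 := norm1_triangle v (x k) (c j); have h2 := Cc _ _ Cv.
  by rewrite -/me (norm1_dist v) in h2 h1 *; rewrite (norm1_dist v (x k)); lra.
apply: (@le_trans _ _ (\sum_(0 <= j <oo)
    (N%:R^-1)%:E * \sum_(k < N) \int[nu k]_(v in C j) phi k v)).
  apply: lee_nneseries => [j _ _|j _]; first exact: integral_ge0.
  exact: cell_le.
rewrite nneseriesZl; last first.
  by move=> j _; apply: sume_ge0 => k _; exact: integral_ge0.
rewrite nneseries_sum; last by move=> k j _; exact: integral_ge0.
rewrite lee_wpmul2l ?lee_fin//; apply: lee_sum => k _.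
by rewrite -ge0_integral_bigcup// UC.
Qed.

End mixture_transport.

(** * The displacement of the sample points *)

Section inflation.
Local Open Scope ereal_scope.
Context {R : realType} {m N : nat}.
Hypothesis N_gt0 : (0 < N)%N.
Implicit Types (x : 'I_N -> 'rV[R]_m) (Xi : set 'rV[R]_m).

Let n0 (v : 'rV[R]_m) : 0 <= (norm1 v)%:E.
Proof. by rewrite lee_fin norm1_ge0. Qed.

Let mn12 : measurable_fun setT (fun z : 'rV[R]_m * 'rV[R]_m => (norm1 (z.1 - z.2))%:E).
Proof. by apply/measurable_EFinP; exact: measurable_fun_norm1B. Qed.

Lemma average_cst (a : R) : (N%:R^-1)%:E * \sum_(k < N) a%:E = a%:E.
Proof.
rewrite sumEFin sumr_const card_ord -EFinM -[(a *+ N)%R]mulr_natl mulrA mulVf ?mul1r//.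
by rewrite pnatr_eq0 -lt0n.
Qed.

Lemma wasserstein_coupling (mu nu : {measure set 'rV[R]_m -> \bar R}) (r e : R) :
  wasserstein mu nu <= r%:E -> (0 < e)%R ->
  exists2 pi, couplings mu nu pi &
    \int[pi]_z (norm1 (z.1 - z.2))%:E <= (r + e)%:E.
Proof.
move=> Wr e0; have : wasserstein mu nu < (r + e)%:E.
  by apply: le_lt_trans Wr _; rewrite lte_fin ltrDl.
by move=> /ereal_inf_lt[_ [pi cpi <-] /ltW h]; exists pi.
Qed.

Lemma coupling_average x (P : {measure set 'rV[R]_m -> \bar R}) pi :
  couplings P (empirical x) pi ->
  exists Q : 'I_N -> {measure set 'rV[R]_m -> \bar R},
    [/\ forall k, Q k setT = 1,
      forall B, measurable B -> P B = mixture Q B,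
      forall f : 'rV[R]_m -> \bar R, measurable_fun setT f -> (forall v, 0 <= f v) ->
        \int[pi]_z f z.2 = (N%:R^-1)%:E * \sum_(k < N) f (x k) &
      \int[pi]_z (norm1 (z.1 - z.2))%:E =
        (N%:R^-1)%:E * \sum_(k < N) \int[Q k]_y (norm1 (y - x k))%:E].
Proof.
move=> cpi; have [|Q [Q1 QE]] := @coupling_empirical R m N x N_gt0 pi.
  by move=> A mA; have [] := cpi A mA.
exists Q; split => //.
- move=> B mB; have [<- _] := cpi B mB.
  have mBT : measurable (B `*` [set: 'rV[R]_m]) by exact: measurableX.
  transitivity (\int[pi]_z (\1_(B `*` [set: 'rV[R]_m]) z)%:E).
    by rewrite integral_indic// setIT.
  rewrite QE//; last by apply/measurable_EFinP; exact: measurable_indic.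
  rewrite /mixture; congr (_ * _); apply: eq_bigr => k _.
  transitivity (\int[Q k]_y (\1_B y)%:E); last by rewrite integral_indic// setIT.
  apply: eq_integral => y _; rewrite !indicE.
  have -> : ((y, x k) \in B `*` [set: 'rV[R]_m]) = (y \in B).
    by apply/idP/idP => [/set_mem[/= + _]|/set_mem yB]; [exact: mem_set|exact/mem_set].
  by [].
- move=> f mf f0; rewrite QE//; last exact: measurableT_comp mf measurable_snd.
  congr (_ * _); apply: eq_bigr => k _ /=.
  by rewrite integral_cst// Q1 mule1.
- by rewrite QE.
Qed.

(** The Gaussian laws are transported onto the conditional laws of a near-optimal coupling. The
    three terms of the bound are the cell size, the Gaussian spread and the cost of the coupling. *)
Lemma near_optimal_map x (P : {measure set 'rV[R]_m -> \bar R}) (r s e : R) :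
  (0 < m)%N -> (0 < s)%R -> (0 < e)%R -> wasserstein P (empirical x) <= r%:E ->
  exists2 T, transport_maps (gaussian_mixture x ((s ^+ 2)%:M)) P T &
    \int[gaussian_mixture x ((s ^+ 2)%:M)]_v (norm1 (v - T v))%:E <=
    (2 * (m%:R * e) + m%:R * (Num.sqrt 2 * s) + (r + e))%:E.
Proof.
move=> m0 s0 e0 /wasserstein_coupling/(_ e0)[pi cpi costpi].
have [Q [Q1 PQ _ Qcost]] := coupling_average cpi.
have [||T mT [TE Tcost]] := @mixture_transport R m N (Ordinal m0) x
  (fun k => gaussian (x k) ((s ^+ 2)%:M)) Q e N_gt0 _ Q1 _ e0.
- by move=> k; exact: gaussian_setT.
- by move=> k c; exact: gaussian_hyperplane.
exists T; first by split => // A mA; rewrite PQ// -TE.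
apply: le_trans Tcost _.
apply: (@le_trans _ _ ((N%:R^-1)%:E * \sum_(k < N)
   ((2 * (m%:R * e) + m%:R * (Num.sqrt 2 * s))%:E +
    \int[Q k]_y (norm1 (y - x k))%:E))).
  rewrite lee_wpmul2l ?lee_fin//; apply: lee_sum => k _; rewrite leeD2r// EFinD leeD2l//.
  exact: integral_norm1_gaussian.
rewrite big_split/= ge0_muleDr; first last.
- by apply: sume_ge0 => k _; exact: integral_ge0.
- apply: sume_ge0 => k _; rewrite lee_fin addr_ge0// !mulr_ge0//; exact: ltW.
by rewrite average_cst -Qcost [leRHS]EFinD; apply: leeD.
Qed.

Lemma normal_prob_ray_gt0 (a s M : R) : (0 < s)%R ->
  0 < normal_prob a s `]M, +oo[.
Proof.
move=> s0; have s_neq0 : (s != 0)%R by rewrite gt_eqF.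
(* [D] bounds the distance from [a] to the points of []M, M + 1[], so [c] is a positive lower bound
   of the density there. *)
pose D := (`|a| + `|M| + 1)%R.
pose c := (normal_peak s * expR (- D ^+ 2 / (s ^+ 2 *+ 2)))%R.
have c0 : (0 < c)%R by rewrite mulr_gt0 ?expR_gt0// normal_peak_gt0.
apply: (@lt_le_trans _ _ (\int[lebesgue_measure]_(t in `]M, (M + 1)%R[) (cst c%:E) t)).
  rewrite integral_cst//= lebesgue_measure_itv/= lte_fin ltrDl ltr01.
  by rewrite -EFinD addrAC subrr add0r mule1 lte_fin.
apply: (@le_trans _ _ (\int[lebesgue_measure]_(t in `]M, (M + 1)%R[) (normal_pdf a s t)%:E)).
  apply: ge0_le_integral => //.
  - by move=> t _; rewrite lee_fin ltW.
  - by apply: measurable_funTS; apply/measurable_EFinP; exact: measurable_normal_pdf.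
  - move=> t; rewrite /= in_itv/= => /andP[Mt tM].
    rewrite lee_fin normal_pdfE// /c ler_wpM2l ?normal_peak_ge0//.
    rewrite /normal_fun ler_expR !mulNr lerN2 ler_wpM2r//.
      by rewrite invr_ge0 mulrn_wge0// sqr_ge0.
    rewrite -real_normK ?num_real// lerXn2r ?nnegrE//.
      by rewrite /D !addr_ge0.
    apply: le_trans (ler_normB _ _) _; rewrite /D addrC -addrA lerD2l.
    rewrite ler_norml; have := ler_norm M; have := ler_norm (- M); rewrite normrN.
    by move=> h1 h2; apply/andP; split; lra.
rewrite /normal_prob; apply: ge0_subset_integral => //.
- by apply: measurable_funTS; apply/measurable_EFinP; exact: measurable_normal_pdf.
- by move=> t _; rewrite lee_fin normal_pdf_ge0.
- by move=> t /=; rewrite !in_itv/= => /andP[->].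
Qed.

(* The Gaussian mixture charges every half-space whereas [P] has bounded support;
   this rules out negative inflation constants. *)
Lemma transport_cost_gt0 x Xi (P : probability 'rV[R]_m R) (s : R) T :
  (0 < m)%N -> (0 < s)%R -> compact Xi -> P Xi = 1 ->
  transport_maps (gaussian_mixture x ((s ^+ 2)%:M)) P T ->
  0 < \int[gaussian_mixture x ((s ^+ 2)%:M)]_v (norm1 (v - T v))%:E.
Proof.
move=> m0 s0 cXi PXi [mT TP]; have mXi := compact_measurable_rV cXi.
have [M M0 XiM] := compact_norm1_bounded cXi.
set mu := gaussian_mixture _ _.
pose i0 := Ordinal m0.
(* [Xi] lies in the l1 ball of radius [M], so any point of this half-space that [T] sends into [Xi]
   moves by at least 1. *)
pose A := [set v : 'rV[R]_m | `](M + 1)%R, +oo[%classic (v 0%R i0)].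
have mA : measurable A.
  rewrite -[A]setTI; apply: measurable_coor => //; exact: measurable_itv.
have muA : 0 < mu A.
  rewrite /mu/= /mixture mule_gt0 ?lte_fin ?invr_gt0 ?ltr0n//.
  have h k : 0 < gaussian (x k) ((s ^+ 2)%:M) A.
    have mI : measurable (`](M + 1)%R, +oo[%classic : set R) by exact: measurable_itv.
    by rewrite (gaussian_coor (x k) i0 s0 mI); exact: normal_prob_ray_gt0.
  rewrite (bigD1 (Ordinal N_gt0))//=; apply: (lt_le_trans (h (Ordinal N_gt0))).
  by rewrite leeDl//; apply: sume_ge0.
have mTXi : measurable (T @^-1` Xi) by rewrite -[_ @^-1` _]setTI; exact: mT.
have muTC : mu (T @^-1` (~` Xi)) = 0.
  have PC : P (~` Xi) = 0 by rewrite probability_setC// PXi subee.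
  by rewrite -[RHS]PC -(TP _ (measurableC mXi)).
have muB : mu A <= mu (A `&` T @^-1` Xi).
  rewrite -[leRHS]adde0 -muTC.
  apply: (@le_trans _ _ (mu ((A `&` T @^-1` Xi) `|` T @^-1` (~` Xi)))).
    apply: measure_mono => //.
      apply: measurableU; first exact: measurableI.
      by rewrite preimage_setC; exact: measurableC.
    by move=> v Av; have [?|?] := pselect (Xi (T v)); [left|right].
  apply: measureU2; first exact: measurableI.
  by rewrite preimage_setC; exact: measurableC.
apply: (lt_le_trans muA); apply: (le_trans muB).
rewrite -[leLHS]mul1e; apply: ge0_integral_markov => //.
- exact: measurable_fun_norm1B.
- by move=> v; exact: norm1_ge0.
- exact: measurableI.
move=> v [Av TXi].
have : v 0%R i0 \in `](M + 1)%R, +oo[ := Av.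
rewrite in_itv/= andbT => vM.
apply: (le_trans _ (ler_coor_norm1 _ i0)); rewrite !mxE.
have := XiM _ TXi; have := ler_coor_norm1 (T v) i0.
have := ler_norm (T v 0%R i0); have := ler_norm (v 0%R i0 - T v 0%R i0)%R.
lra.
Qed.

Lemma pd_covariance_scalar (s : R) : (0 < s)%R ->
  pd_covariance ((s ^+ 2)%:M : 'M[R]_m).
Proof.
move=> s0; split; first by rewrite tr_scalar_mx.
move=> v v0; rewrite mul_mx_scalar -scalemxAl !mxE mulr_gt0// ?exprn_gt0//.
have [i vi] : exists i, v 0%R i != 0%R.
  apply/existsP; apply: contraNT v0 => /existsPn h; apply/eqP/rowP => i.
  by have := h i; rewrite negbK mxE => /eqP.
rewrite (bigD1 i)//= mxE -expr2 ltr_pwDl ?exprn_even_gt0//=.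
by apply: sumr_ge0 => j _; rewrite mxE -expr2 sqr_ge0.
Qed.

(** Inferability bounds the mixture integral of the displacement of [h] by [Cl l] times the cost of
    a near-optimal map. As [l] grows that cost is at most [kap l], which tends to [r], while [low]
    keeps the integral above the mean displacement at the samples minus [e]. *)
Lemma mean_displacement_le x Xi (P : probability 'rV[R]_m R)
    (h : 'rV[R]_m -> 'rV[R]_m) (C r : R) (phi : nat -> nat) :
  (0 < m)%N -> compact Xi -> P Xi = 1 -> measurable_fun setT h ->
  (forall l, (l <= phi l)%N) ->
  (forall k (e : R), (0 < e)%R -> \forall l \near \oo,
    (norm1 (x k - h (x k)) - e)%:E <=
    \int[sgauss (phi l).+1%:R^-1 (x k)]_v (norm1 (v - h v))%:E) ->
  inferable P x h C -> wasserstein P (empirical x) <= r%:E ->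
  (0 <= C)%R /\ (N%:R^-1 * \sum_(k < N) norm1 (x k - h (x k)) <= C * r)%R.
Proof.
move=> m0 cXi PXi mh lphi low inf Wr.
pose s l : R := (phi l).+1%:R^-1%R.
have s0 l : (0 < s l)%R by rewrite invr_gt0.
have s_cvg : s l @[l --> \oo] --> (0 : R)%R.
  apply: (@squeeze_cvgr _ _ _ _ (cst 0%R) (fun l => l.+1%:R^-1 : R)%R).
  - apply: nearW => l; rewrite ltW//= lef_pV2 ?posrE// ler_nat ltnS; exact: lphi.
  - exact: cvg_cst.
  - exact: cvg_harmonic.
have Sigma_cvg : ((s l ^+ 2)%:M : 'M[R]_m) @[l --> \oo] --> (0%R : 'M[R]_m).
  under eq_fun do rewrite -scalemx1.
  rewrite -(scale0r (1%:M : 'M[R]_m)); apply: cvgZr_tmp.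
  rewrite -(mul0r 0%R); under eq_fun do rewrite expr2.
  exact: cvgM.
have [Cl [ClT Cl_cvg]] := inf (fun l => (s l ^+ 2)%:M)
  (fun l => pd_covariance_scalar (s0 l)) Sigma_cvg.
pose mu l : {measure set 'rV[R]_m -> \bar R} := gaussian_mixture x ((s l ^+ 2)%:M).
(* The cell size and the slack of the coupling are both taken equal to [s l], so a single limit
   removes all errors. *)
pose kap l := (2 * (m%:R * s l) + m%:R * (Num.sqrt 2 * s l) + (r + s l))%R.
have /choice[T hT] : forall l, exists T, transport_maps (mu l) P T /\
    \int[mu l]_v (norm1 (v - T v))%:E <= (kap l)%:E.
  by move=> l; have [T tT Tc] := near_optimal_map m0 (s0 l) (s0 l) Wr; exists T.
pose K l := \int[mu l]_v (norm1 (v - T l v))%:E.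
have K_gt0 l : 0 < K l by exact: (transport_cost_gt0 m0 (s0 l) cXi PXi (hT l).1).
have K_le l : K l <= (kap l)%:E by case: (hT l).
have K_fin l : K l \is a fin_num.
  by rewrite ge0_fin_numE ?(ltW (K_gt0 l))// (le_lt_trans (K_le l))// ltry.
have hK l : \int[mu l]_v (norm1 (v - h v))%:E <= (Cl l)%:E * K l.
  exact: (ClT l (T l) (hT l).1).
have hint0 l : 0 <= \int[mu l]_v (norm1 (v - h v))%:E by exact: integral_ge0.
(* Positivity of the cost fixes the sign of [Cl l]; the sign is needed at the end to replace the
   cost by its upper bound [kap l]. *)
have Cl_ge0 l : (0 <= Cl l)%R.
  rewrite leNgt; apply/negP => Cl_lt0.
  have := le_trans (hint0 l) (hK l); rewrite leNgt => /negP; apply.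
  by rewrite mule_lt0_gt0// lte_fin.
have C0 : (0 <= C)%R.
  rewrite -(cvg_lim _ Cl_cvg)//; apply: limr_ge; last exact: nearW.
  by apply/cvg_ex; exists C.
split=> //.
have kap_cvg : kap l @[l --> \oo] --> r.
  rewrite (_ : r = 2 * (m%:R * 0) + m%:R * (Num.sqrt 2 * 0) + (r + 0))%R; last first.
    by rewrite !mulr0 !add0r addr0.
  apply: cvgD; last by apply: cvgD => //; exact: cvg_cst.
  by apply: cvgD; apply: cvgMr; exact: cvgMr.
have mnh : measurable_fun setT (fun v : 'rV[R]_m => (norm1 (v - h v))%:E).
  by apply/measurable_EFinP; exact: measurable_fun_norm1B.
apply/ler_addgt0Pr => e e0; rewrite -lerBlDr.
have prod_cvg : (Cl l * kap l)%R @[l --> \oo] --> (C * r)%R by exact: cvgM.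
rewrite -(cvg_lim _ prod_cvg)//; apply: limr_ge.
  by apply/cvg_ex; eexists; exact: prod_cvg.
have low_all : \forall l \near \oo, forall k, (norm1 (x k - h (x k)) - e)%:E <=
    \int[sgauss (s l) (x k)]_v (norm1 (v - h v))%:E.
  have : \forall l \near \oo, forall k, k \in index_enum 'I_N ->
      (norm1 (x k - h (x k)) - e)%:E <= \int[sgauss (s l) (x k)]_v (norm1 (v - h v))%:E.
    elim: (index_enum 'I_N) => [|k ks IH]; first by apply: nearW.
    near=> l => k'; rewrite inE => /predU1P[->|].
      by near: l; exact: low.
    by move: k'; near: l; exact: IH.
  by apply: filterS => l hl k; apply: hl; rewrite mem_index_enum.
apply: filterS low_all => l hl.
have : (N%:R^-1 * \sum_(k < N) norm1 (x k - h (x k)) - e)%:E <= (Cl l)%:E * K l.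
  apply: le_trans (hK l); rewrite ge0_integral_mixture//.
  have -> : (N%:R^-1 * \sum_(k < N) norm1 (x k - h (x k)) - e =
      N%:R^-1 * \sum_(k < N) (norm1 (x k - h (x k)) - e))%R.
    rewrite sumrB mulrBr sumr_const card_ord -[(e *+ N)%R]mulr_natl.
    by rewrite mulrA mulVf ?mul1r// pnatr_eq0 -lt0n.
  rewrite EFinM -sumEFin lee_wpmul2l ?lee_fin//; apply: lee_sum => k _.
  exact: hl.
rewrite -(fineK (K_fin l)) -EFinM lee_fin => /le_trans; apply.
by rewrite ler_wpM2l// -lee_fin fineK.
Unshelve. all: by end_near. Qed.

End inflation.

(** * Moving the centre of a ball, and comparing expectations within a ball *)

Section probability_of_mass_one.
Context d (T : measurableType d) (R : realType).
Variables (nu : {measure set T -> \bar R}) (nu1 : nu setT = 1%E).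

(** The dummy binding keeps the proof [nu1] in the term, so that the probability structure can be
    attached to it. *)
Definition as_probability : set T -> \bar R := let _ := nu1 in nu.

HB.instance Definition _ := Measure.on as_probability.
HB.instance Definition _ :=
  Measure_isProbability.Build _ _ _ as_probability nu1.

End probability_of_mass_one.

Section displaced_centre.
Local Open Scope ereal_scope.
Context {R : realType} {m N : nat}.
Hypothesis N_gt0 : (0 < N)%N.
Implicit Types (x : 'I_N -> 'rV[R]_m) (Xi : set 'rV[R]_m).

(** Applying [h] to the second coordinate of a coupling adds at most the integral of the
    displacement, which is its sample mean because the second marginal is the empirical law. *)
Lemma wasserstein_displaced x (P : {measure set 'rV[R]_m -> \bar R})
    (h : 'rV[R]_m -> 'rV[R]_m) (r t : R) :
  measurable_fun setT h -> wasserstein P (empirical x) <= r%:E ->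
  (N%:R^-1 * \sum_(k < N) norm1 (x k - h (x k)) <= t)%R ->
  wasserstein P (empirical (h \o x)) <= (r + t)%:E.
Proof.
move=> mh Wr ht; apply/lee_addgt0Pr => e e0.
have [pi cpi pic] := wasserstein_coupling Wr e0.
have [Q [_ _ piI _]] := coupling_average N_gt0 cpi.
pose g (z : 'rV[R]_m * 'rV[R]_m) := (z.1, h z.2).
have mg : measurable_fun setT g.
  by apply/measurable_fun_pairP; split; [exact: measurable_fst|exact: measurableT_comp mh measurable_snd].
have mn12 : measurable_fun setT (fun z : 'rV[R]_m * 'rV[R]_m => (norm1 (z.1 - z.2))%:E).
  by apply/measurable_EFinP; exact: measurable_fun_norm1B.
have [nu [nuE nuI]] := weighted_image pi (1%:nng)%R measurableT mg.
have {}nuE B : measurable B -> nu B = pi (g @^-1` B).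
  by move=> mB; rewrite nuE// mul1e setIT.
have nu1 : nu setT = 1 by rewrite nuE// preimage_setT probability_setT.
pose pi' : probability _ R := as_probability nu1.
have cpi' : couplings P (empirical (h \o x)) pi'.
  move=> A mA; have [piA _] := cpi A mA.
  have mhA : measurable (h @^-1` A) by rewrite -[_ @^-1` _]setTI; exact: mh.
  have [_ piB] := cpi _ mhA; split.
    by rewrite [LHS]nuE//; exact: measurableX.
  rewrite [LHS]nuE; last exact: measurableX.
  rewrite (_ : g @^-1` _ = setT `*` h @^-1` A); last by apply/seteqP; split=> z.
  exact: piB.
apply: (@le_trans _ _ (\int[pi']_z (norm1 (z.1 - z.2))%:E)).
  by apply: ereal_inf_lbound; exists pi'.
rewrite [leLHS](nuI (fun z => (norm1 (z.1 - z.2))%:E))//; last first.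
  by move=> z; rewrite lee_fin norm1_ge0.
rewrite mul1e.
have mf : measurable_fun setT (fun v : 'rV[R]_m => (norm1 (v - h v))%:E).
  by apply/measurable_EFinP; exact: measurable_fun_norm1B.
have mf2 : measurable_fun setT (fun z : 'rV[R]_m * 'rV[R]_m => (norm1 (z.2 - h z.2))%:E).
  exact: measurableT_comp mf measurable_snd.
apply: (@le_trans _ _ (\int[pi]_z ((norm1 (z.1 - z.2))%:E + (norm1 (z.2 - h z.2))%:E))).
  apply: ge0_le_integral => //.
  - by move=> z _; rewrite lee_fin norm1_ge0.
  - exact: (measurableT_comp mn12 mg).
  - exact: emeasurable_funD.
  - by move=> z _; rewrite -EFinD lee_fin; exact: norm1_triangle.
rewrite ge0_integralD//; first last.
- by move=> z _; rewrite lee_fin norm1_ge0.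
- by move=> z _; rewrite lee_fin norm1_ge0.
rewrite (piI _ mf); last by move=> v; rewrite lee_fin norm1_ge0.
rewrite sumEFin -EFinM.
have -> : (r + t)%:E + e%:E = (r + e)%:E + t%:E by rewrite -!EFinD addrAC.
by apply: leeD; [exact: pic|rewrite lee_fin; exact: ht].
Qed.

(** For each [k] the Lipschitz bound compares [v] under [A k] with [w] under [B k], both in [Xi];
    the triangle inequality through [y k] is applied to the norm only, so [G] is never compared at
    [y k], which may lie outside [Xi]. *)
Lemma lipschitz_integral_le (y : 'I_N -> 'rV[R]_m) Xi (P Q : probability 'rV[R]_m R)
    (G : 'rV[R]_m -> R) (K r : R) :
  measurable Xi -> P Xi = 1 -> Q Xi = 1 ->
  wasserstein P (empirical y) <= r%:E -> wasserstein Q (empirical y) <= r%:E ->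
  (0 <= K)%R -> measurable_fun setT G -> (forall v, 0 <= G v)%R ->
  (forall v w, Xi v -> Xi w -> G v <= G w + K * norm1 (v - w))%R ->
  \int[P]_v (G v)%:E <= \int[Q]_v (G v)%:E + (2 * (K * r))%:E.
Proof.
move=> mXi PXi QXi WP WQ K0 mG G0 GK.
apply/lee_addgt0Pr => e e0.
have K10 : (0 < 2 * (K + 1))%R by rewrite mulr_gt0// ltr_wpDl.
(* The two couplings cost an extra [2 * K * e'], at most [e]; [K + 1] avoids a division by 0. *)
pose e' := (e / (2 * (K + 1)))%R; have e'0 : (0 < e')%R by rewrite divr_gt0.
have [pi1 c1 cost1] := wasserstein_coupling WP e'0.
have [pi2 c2 cost2] := wasserstein_coupling WQ e'0.
have [A [A1 PA _ costA]] := coupling_average N_gt0 c1.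
have [B [B1 QB _ costB]] := coupling_average N_gt0 c2.
(* A law concentrated on [Xi] forces every component of its mixture to be concentrated there, since
   each has the positive weight 1/N. *)
have null (F : 'I_N -> {measure set 'rV[R]_m -> \bar R}) (Z : probability 'rV[R]_m R) :
    Z Xi = 1 -> (forall D, measurable D -> Z D = mixture F D) ->
    forall k, F k (~` Xi) = 0.
  move=> ZXi ZF k; have ZC : Z (~` Xi) = 0 by rewrite probability_setC// ZXi subee.
  move: ZC; rewrite ZF; last exact: measurableC.
  rewrite /mixture => /eqP; rewrite mule_eq0 => /orP[|].
    by rewrite eqe invr_eq0 pnatr_eq0 => /eqP N0; move: N_gt0; rewrite N0.
  move=> /eqP S0; apply/eqP; rewrite eq_le measure_ge0 andbT -S0 (bigD1 k)//=.
  by rewrite leeDl//; apply: sume_ge0.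
have A0 := null A P PXi PA; have B0 := null B Q QXi QB.
have mGE : measurable_fun setT (fun v => (G v)%:E) by apply/measurable_EFinP.
have GE0 v : 0 <= (G v)%:E by rewrite lee_fin.
have mn k : measurable_fun setT (fun v : 'rV[R]_m => (norm1 (v - y k))%:E).
  by apply/measurable_EFinP; exact: measurable_fun_norm1B.
have n0 (v : 'rV[R]_m) : 0 <= (norm1 v)%:E by rewrite lee_fin norm1_ge0.
have mKn k : measurable_fun setT (fun v : 'rV[R]_m => K%:E * (norm1 (v - y k))%:E).
  exact: measurable_funeM.
have Kn0 (v : 'rV[R]_m) : 0 <= K%:E * (norm1 v)%:E by rewrite mule_ge0// lee_fin.
have intXi (F : {measure set 'rV[R]_m -> \bar R}) (f : 'rV[R]_m -> \bar R) :
    F (~` Xi) = 0 -> measurable_fun setT f -> (forall v, 0 <= f v) ->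
    \int[F]_v f v = \int[F]_(v in Xi) f v.
  move=> F0 mf f0; rewrite (ge0_negligible_integral (N := ~` Xi))//.
    by rewrite setTD setCK.
  exact: measurableC.
have step k : \int[A k]_v (G v)%:E <= \int[B k]_v (G v)%:E +
    K%:E * \int[A k]_v (norm1 (v - y k))%:E + K%:E * \int[B k]_v (norm1 (v - y k))%:E.
  have inner v : Xi v -> (G v)%:E <= \int[B k]_w (G w)%:E +
      K%:E * (norm1 (v - y k))%:E + K%:E * \int[B k]_v (norm1 (v - y k))%:E.
    move=> Xv; rewrite -[leLHS]mule1 -(B1 k) -(integral_cst (B k) measurableT).
    apply: (@le_trans _ _ (\int[B k]_w ((G w)%:E + K%:E * (norm1 (v - y k))%:E +
        K%:E * (norm1 (w - y k))%:E))).
      have mR : measurable_fun setT (fun w => (G w)%:E + K%:E * (norm1 (v - y k))%:E +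
          K%:E * (norm1 (w - y k))%:E).
        by apply: emeasurable_funD => //; apply: emeasurable_funD.
      have R0 w : 0 <= (G w)%:E + K%:E * (norm1 (v - y k))%:E +
          K%:E * (norm1 (w - y k))%:E.
        by apply: adde_ge0 => //; exact: adde_ge0.
      rewrite (intXi _ _ (B0 k) mR R0).
      rewrite (intXi _ _ (B0 k) (measurable_cst _)); last by move=> w; exact: GE0.
      apply: ge0_le_integral; [exact: mXi|by move=> w _; exact: GE0|
        exact: measurable_cst|exact: measurable_funTS|].
      move=> w Xw; rewrite /cst -!EFinM -!EFinD lee_fin.
      apply: (le_trans (GK v w Xv Xw)); rewrite -addrA lerD2l -mulrDr ler_wpM2l//.
      by rewrite (norm1_dist w); exact: norm1_triangle.
    rewrite ge0_integralD//; first last.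
    - exact: emeasurable_funD.
    - by move=> w _; exact: adde_ge0.
    rewrite ge0_integralD// (integral_cst (B k) measurableT) B1 mule1.
    by rewrite ge0_integralZl_EFin.
  have IB0 : 0 <= \int[B k]_w (G w)%:E by exact: integral_ge0.
  have InB0 : 0 <= K%:E * \int[B k]_v (norm1 (v - y k))%:E.
    by rewrite mule_ge0 ?lee_fin//; exact: integral_ge0.
  have mR : measurable_fun setT (fun v : 'rV[R]_m => \int[B k]_w (G w)%:E +
      K%:E * (norm1 (v - y k))%:E + K%:E * \int[B k]_v (norm1 (v - y k))%:E).
    by apply: emeasurable_funD => //; apply: emeasurable_funD.
  have R0 v : 0 <= \int[B k]_w (G w)%:E +
      K%:E * (norm1 (v - y k))%:E + K%:E * \int[B k]_v (norm1 (v - y k))%:E.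
    by apply: adde_ge0 => //; exact: adde_ge0.
  apply: (@le_trans _ _ (\int[A k]_v (\int[B k]_w (G w)%:E +
      K%:E * (norm1 (v - y k))%:E + K%:E * \int[B k]_v (norm1 (v - y k))%:E))).
    rewrite (intXi _ _ (A0 k) mR R0) (intXi _ _ (A0 k) mGE GE0).
    apply: ge0_le_integral => //; [exact: measurable_funTS|exact: measurable_funTS].
  rewrite ge0_integralD//; first last.
  - by apply: emeasurable_funD.
  - by move=> v _; exact: adde_ge0.
  rewrite ge0_integralD// !(integral_cst (A k) measurableT) A1 !mule1.
  by rewrite ge0_integralZl_EFin.
have intmix (Z : probability 'rV[R]_m R) F : (forall D, measurable D -> Z D = mixture F D) ->
    \int[Z]_v (G v)%:E = (N%:R^-1)%:E * \sum_(k < N) \int[F k]_v (G v)%:E.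
  by move=> ZF; rewrite -ge0_integral_mixture//; apply: eq_measure_integral => D mD _; exact: ZF.
rewrite (intmix P A PA) (intmix Q B QB).
apply: (@le_trans _ _ ((N%:R^-1)%:E * \sum_(k < N) \int[B k]_v (G v)%:E +
    K%:E * \int[pi1]_z (norm1 (z.1 - z.2))%:E +
    K%:E * \int[pi2]_z (norm1 (z.1 - z.2))%:E)).
  rewrite costA costB.
  have s0 (F : 'I_N -> {measure set 'rV[R]_m -> \bar R}) :
      0 <= \sum_(k < N) \int[F k]_v (norm1 (v - y k))%:E.
    by apply: sume_ge0 => k _; exact: integral_ge0.
  have sG0 : 0 <= \sum_(k < N) \int[B k]_v (G v)%:E.
    by apply: sume_ge0 => k _; exact: integral_ge0.
  rewrite !(muleCA K%:E) -!ge0_muleDr ?adde_ge0 ?mule_ge0//.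
  rewrite lee_wpmul2l ?lee_fin//.
  have KE (F : 'I_N -> {measure set 'rV[R]_m -> \bar R}) :
      K%:E * \sum_(k < N) \int[F k]_v (norm1 (v - y k))%:E =
      \sum_(k < N) K%:E * \int[F k]_v (norm1 (v - y k))%:E.
    by rewrite ge0_sume_distrr// => k _; exact: integral_ge0.
  by rewrite !KE -!big_split/=; apply: lee_sum => k _; exact: step.
rewrite -!addeA leeD2l//.
apply: (@le_trans _ _ (K%:E * (r + e')%:E + K%:E * (r + e')%:E)).
  by apply: leeD; rewrite lee_wpmul2l// lee_fin.
rewrite -!EFinM -!EFinD lee_fin.
have -> : (K * (r + e') + K * (r + e') = 2 * (K * r) + 2 * K * e')%R by ring.
rewrite lerD2l /e' mulrA ler_pdivrMr// mulrC ler_wpM2l ?ltW//.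
by lra.
Qed.

End displaced_centre.

(** * Equilibria *)

Section nash_transfer.
Context {R : realType} {n m N : nat} {dim : 'I_n -> nat}.
Variables (S : forall i, set 'rV[R]_(dim i)) (Xi : set 'rV[R]_m).
Variables (U : 'I_n -> profile R dim -> 'rV[R]_m -> R) (L : 'I_n -> R).
Hypothesis N_gt0 : (0 < N)%N.
Hypothesis Xi_compact : compact Xi.
Hypothesis U_standing : forall i, standing S Xi U L i.

(** The utility is bounded on the compact [Xi]. Adding the bound [b] and extending by 0 gives a
    nonnegative function on the whole space, and [b] cancels because both laws have mass one on
    [Xi]. *)
Lemma US_lipschitz_le (y : 'I_N -> 'rV[R]_m) (P Q : probability 'rV[R]_m R)
    (i : 'I_n) (s : profile R dim) (r : R) :
  strategies S s -> wball Xi r (empirical y) P -> wball Xi r (empirical y) Q ->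
  (US Xi U P i s <= US Xi U Q i s + (2 * (L i * r))%:E)%E.
Proof.
move=> Ss [[PXi _ _] WP] [[QXi _ _] WQ].
have [_ [_ [Li0 Ulip]]] := U_standing i.
have mXi := compact_measurable_rV Xi_compact.
have [M M0 XiM] := compact_norm1_bounded Xi_compact.
have {}Ulip := Ulip s Ss.
have mU : measurable_fun Xi (U i s) by exact: lipschitz_measurable mXi Li0 Ulip.
have [b b0 Ub] : exists2 b, 0 <= b & forall v, Xi v -> `|U i s v| <= b.
  have [[v0 Xv0]|nXi] := pselect (Xi !=set0); last first.
    by exists 0 => [|v Xv]; [exact: lexx|exfalso; apply: nXi; exists v].
  (* The value at one point plus the Lipschitz constant times a bound on the diameter of [Xi]. *)
  exists (`|U i s v0| + L i * (2 * M)) => [|v Xv].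
    by rewrite addr_ge0// mulr_ge0// mulr_ge0// ltW.
  rewrite -[X in `|X|](subrK (U i s v0)) addrC.
  rewrite (le_trans (ler_normD _ _))// lerD2l.
  apply: (le_trans (Ulip v v0 Xv Xv0)); rewrite ler_wpM2l//.
  apply: (le_trans (norm1D _ _)); rewrite norm1N.
  by have := XiM _ Xv; have := XiM _ Xv0; lra.
have mUE : measurable_fun Xi (fun v => (U i s v)%:E) by apply/measurable_EFinP.
have iU (Z : probability 'rV[R]_m R) : Z.-integrable Xi (fun v => (U i s v)%:E).
  apply/integrableP; split => //.
  apply: (@le_lt_trans _ _ (\int[Z]_(v in Xi) (cst b%:E) v)%E).
    apply: ge0_le_integral => //.
    - by apply: measurableT_comp.
  rewrite integral_cst// -ge0_fin_numE; last by rewrite mule_ge0// lee_fin.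
  by rewrite fin_numM// fin_num_measure.
pose G v := if v \in Xi then U i s v + b else 0.
have shift (Z : probability 'rV[R]_m R) : Z Xi = 1%E ->
    (\int[Z]_v (G v)%:E = US Xi U Z i s + b%:E)%E.
  move=> ZXi; have -> : (b%:E = \int[Z]_(v in Xi) (cst b%:E) v)%E.
    by rewrite integral_cst// [X in (_ * X)%E]ZXi mule1.
  have icst : Z.-integrable Xi (cst b%:E).
    apply/integrableP; split; first exact: measurable_cst.
    under eq_integral do rewrite /= ger0_norm//.
    by rewrite integral_cst// [X in (_ * X)%E]ZXi mule1 ltry.
  rewrite /US -(integralD mXi (iU Z) icst) [RHS]integral_mkcond.
  apply: eq_integral => v _.
  by rewrite patchE /G; case: (v \in Xi).
have mG : measurable_fun setT G.
  apply: (measurable_restrictT (fun v => U i s v + b) mXi).1.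
  exact: measurable_funD.
have G0 v : 0 <= G v.
  rewrite /G; case: ifPn => // /set_mem Xv.
  by have := Ub _ Xv; rewrite ler_norml => /andP[]; lra.
have GU v w : Xi v -> Xi w -> G v <= G w + L i * norm1 (v - w).
  move=> Xv Xw; rewrite /G !mem_set//.
  have := Ulip v w Xv Xw; rewrite ler_norml => /andP[_]; lra.
have := lipschitz_integral_le N_gt0 mXi PXi QXi WP WQ Li0 mG G0 GU.
rewrite !shift// => h.
have bfin : b%:E \is a fin_num by [].
by rewrite -(leeD2rE _ _ bfin); apply: (le_trans h); rewrite addeAC.
Qed.

(** [UDR] is below [US] since [P] is in the ball, and [US] is below [UDR] plus [eta] by comparing
    [P] with every law of the ball. The equilibrium inequality for [UDR] is placed between these two
    bounds. *)
Lemma nash_transfer (y : 'I_N -> 'rV[R]_m) (P : probability 'rV[R]_m R)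
    (r : 'I_n -> R) (eta : R) (s : profile R dim) :
  (forall i, wball Xi (r i) (empirical y) P) ->
  (forall i, 2 * (L i * r i) <= eta) ->
  NE S (UDR Xi U r (empirical y)) 0 s -> NE S (US Xi U P) eta s.
Proof.
move=> Pball hr [Ss sNE]; split=> // i x Sx.
have Sd : strategies S (dfwith s i x).
  by move=> j; case: dfwithP => // k ki; exact: Ss.
apply: (@le_trans _ _ (UDR Xi U r (empirical y) i (dfwith s i x) + eta%:E)%E).
  rewrite -leeBlDr//; apply: le_ereal_inf_tmp => _ [Q Qball <-].
  rewrite leeBlDr//; apply: (le_trans (US_lipschitz_le i Sd (Pball i) Qball)).
  by rewrite leeD2l// lee_fin.
rewrite leeD2r//; have := sNE i x Sx; rewrite adde0 => /le_trans; apply.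
by apply: ereal_inf_lbound; exists P.
Qed.

End nash_transfer.

(** * The good event and its probability *)

Theorem theorem19 (R : realType) (n m : nat) (m_gt0 : (0 < m)%N)
    (dim : 'I_n -> nat) (S : forall i, set 'rV[R]_(dim i))
    (Xi : set 'rV[R]_m) (Xi_compact : compact Xi)
    (U : 'I_n -> profile R dim -> 'rV[R]_m -> R) (L : 'I_n -> R)
    (U_standing : forall i, standing S Xi U L i)
    (a : R) (a_gt1 : 1 < a)
    (Pstar : probability 'rV[R]_m R) (Pstar_M : MXi Xi Pstar)
    (Pstar_ac : Pstar `<< lebesgue_rV m) (Pstar_light : light_tailed a Pstar)
    (p : 'I_n -> nat) (pm : (\sum_i p i)%N = m)
    (hs : forall i, 'rV[R]_m -> 'rV[R]_(p i))
    (h_bij : bijective (stacked pm hs))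
    (h_meas : measurable_fun setT (stacked pm hs))
    (c1 c2 : R) (c1_gt0 : 0 < c1) (c2_gt0 : 0 < c2)
    (N : nat) (N_gt0 : (0 < N)%N)
    (c1c2 : concentration Xi Pstar a c1 c2 N)
    (d : measure_display) (Omega : measurableType d) (P : probability Omega R)
    (X : 'I_N -> {RV P >-> 'rV[R]_m}) (X_iid : iid X Pstar)
    (C : R)
    (h_inferable : {ae P, forall w,
      inferable Pstar (fun k => X k w) (stacked pm hs) C})
    (theta : 'I_n -> R) (theta01 : forall i, 0 < theta i < 1)
    (sstar : Omega -> profile R dim)
    (sstar_NE : {ae P, forall w,
      NE S (UDR Xi U (fun i => (C + 1) * conc_radius m a c1 c2 N (theta i))
                (empirical (fun k => stacked pm hs (X k w)))) 0 (sstar w)}) :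
  prob_at_least P ((1 - \big[Num.max/0]_i theta i) ^+ n)
    [set w | NE S (US Xi U Pstar)
      (2 * (C + 1) * \big[Num.max/0]_i (conc_radius m a c1 c2 N (theta i) * L i))
      (sstar w)].
Proof.
set h := stacked pm hs in h_bij h_meas h_inferable sstar_NE *.
set rad := fun i => conc_radius m a c1 c2 N (theta i).
(* Without agents every profile is an equilibrium and the maximum of the levels takes its default
   0. *)
have [i0|n0] := pselect (inhabited 'I_n); last first.
  have noI (i : 'I_n) : False by apply: n0.
  exists setT; split; first exact: measurableT.
  - by move=> w _; split=> [i|i]; case: (noI i).
  - rewrite (eq_bigl pred0) => [|i]; last by case: (noI i).
    by rewrite big_pred0_eq subr0 expr1n probability_setT.
have [j rad_min] : exists j, forall i, rad j <= rad i.
  case: i0 => i0; have [j _ hj] := arg_minP (P := predT) (i0 := i0) rad isT.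
  by exists j => i; exact: hj.
have [F [mF Fball PF]] := c1c2 _ _ _ _ X_iid _ (theta01 j).
pose f (v : 'rV[R]_m) := norm1 (v - h v).
have mf : measurable_fun setT f by exact: measurable_fun_norm1B.
have [phi [lphi [A [mA A0 GA]]]] := ae_sgauss_liminf mf (fun v => norm1_ge0 _).
(* Absolute continuity makes the Lebesgue-null exceptional set null for [Pstar], hence almost surely
   avoided by every sample. *)
have PA : Pstar A = 0%E.
  by have /null_content_dominatesP := Pstar_ac; apply.
have good : {ae P, forall w, forall k, ~ A (X k w)}.
  apply: filter_forall => k; exists (X k @^-1` A); split.
  - by rewrite -[_ @^-1` _]setTI; apply: measurable_funP.
  - by have [XP _] := X_iid; rewrite -PA -(XP k A mA).
  - by move=> w /=; rewrite notE.
have [B [mB B0 GB]] : {ae P, forall w, [/\ inferable Pstar (fun k => X k w) h C,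
    NE S (UDR Xi U (fun i => (C + 1) * rad i) (empirical (fun k => h (X k w))))
      0 (sstar w) & forall k, ~ A (X k w)]}.
  by apply: filterS3 h_inferable sstar_NE good => w *; split.
exists (F `\` B); split; first exact: measurableD.
  move=> w [Fw nBw].
  have [inf sNE nA] : [/\ inferable Pstar (fun k => X k w) h C,
    NE S (UDR Xi U (fun i => (C + 1) * rad i) (empirical (fun k => h (X k w))))
      0 (sstar w) & forall k, ~ A (X k w)].
    by apply: contrapT => nG; apply: nBw; exact: GB.
  have [_ Wj] := Fball w Fw.
  have [PXi _ _] := Pstar_M.
  have low k (e : R) : 0 < e -> \forall l \near \oo, ((f (X k w) - e)%:E <=
      \int[sgauss (phi l).+1%:R^-1 (X k w)]_v (f v)%:E)%E.
    move: e; apply: contrapT => nlow; apply: (nA k); exact: GA.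
  have [C0 disp] := mean_displacement_le N_gt0 m_gt0 Xi_compact PXi h_meas lphi low inf Wj.
  have WP := wasserstein_displaced N_gt0 h_meas Wj disp.
  (* The sign lets the radius [(C + 1) * rad j] be enlarged to that of any agent. *)
  have C10 : 0 <= C + 1 by rewrite addr_ge0.
  have Pball i : wball Xi ((C + 1) * rad i) (empirical (fun k => h (X k w))) Pstar.
    split=> //; apply: (le_trans WP); rewrite lee_fin addrC -[X in _ + X]mul1r -mulrDl.
    by rewrite ler_wpM2l.
  apply: (nash_transfer N_gt0 Xi_compact U_standing Pball) sNE => i.
  rewrite -mulrA ler_wpM2l// mulrCA ler_wpM2l// mulrC.
  exact: (le_bigmax _ (fun i => rad i * L i)).
have th_le : theta j <= \big[Num.max/0]_i theta i by exact: le_bigmax.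
have th0 : 0 <= \big[Num.max/0]_i theta i.
  by apply: le_trans th_le; case/andP: (theta01 j) => /ltW.
have th1 : \big[Num.max/0]_i theta i <= 1.
  by apply/bigmax_leP; split => // i _; case/andP: (theta01 i) => _ /ltW.
(* A positive power of a number of [[0, 1]] does not exceed it; [n] is positive because the agent
   [j] exists. *)
apply: (@le_trans _ _ (1 - theta j)%:E).
  rewrite lee_fin; apply: (@le_trans _ _ (1 - \big[Num.max/0]_i theta i)).
    have n_gt0 : (0 < n)%N by case: (posnP n) => // n0; move: (j); rewrite n0 => -[].
    rewrite -[leRHS]expr1 ler_wiXn2l// ?subr_ge0//.
    by rewrite lerBlDr lerDl.
  by rewrite lerD2l lerN2.
(* Removing the null set [B] from the concentration event [F] costs no probability. *)
apply: (le_trans PF); apply: (@le_trans _ _ (P ((F `\` B) `|` B))).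
  apply: measure_mono => //; first by apply: measurableU => //; exact: measurableD.
  by move=> w Fw; have [Bw|nBw] := pselect (B w); [right|left].
rewrite -[leRHS]adde0 -B0; apply: measureU2 => //; exact: measurableD.
Qed.
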